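(* Let $\Phi$, $\lambda$, $f$, $\mathcal D$ be as in the context. For $s>0$, $z>0$, $\tilde z>0$ define $R=\operatorname{acosh}\big(\frac{s^2}{2z\tilde z}+\frac12(\frac{z}{\tilde z}+\frac{\tilde z}{z})\big)$, $d=\sqrt{s^2+(z-\tilde z)^2\cosh^2 R}$, $r=z\sinh R$, $\tilde r=\tilde z\sinh R$, $c=z\cosh R$, $\tilde c=\tilde z\cosh R$, $h=\frac{(\tilde r-r+d)(r+\tilde r-d)}{2d}$, $\tilde h=\frac{(r-\tilde r+d)(r+\tilde r-d)}{2d}$, $\delta=\frac\pi2-\arcsin\frac{\tilde c-c}{d}$, $\tilde\delta=\frac\pi2-\arcsin\frac{c-\tilde c}{d}$, and $$\begin{aligned}F(s,z,\tilde z)={}&\pi\int_{-r}^{r}f(w+c)(r^2-w^2)\,dw+\pi\int_{-\tilde r}^{\tilde r}f(w+\tilde c)(\tilde r^2-w^2)\,dw\\&-\int_{r-h}^{r}\int_0^{2\pi}\int_0^{\sqrt{r^2-w^2}}f\big(c+w\cos\delta-\rho\cos\theta\sin\delta\big)\,\rho\,d\rho\,d\theta\,dw\\&-\int_{\tilde r-\tilde h}^{\tilde r}\int_0^{2\pi}\int_0^{\sqrt{\tilde r^2-w^2}}f\big(\tilde c+w\cos\tilde\delta-\rho\cos\theta\sin\tilde\delta\big)\,\rho\,d\rho\,d\theta\,dw.\end{aligned}$$ ($F$ does not depend on $\lambda$ or $\mathcal D$.) Then for any two distinct points $a=(x,y,z)$, $b=(\tilde x,\tilde y,\tilde z)$ of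 $\mathbb{H}^3$, the probability that $a\overset{\Phi\cup\{a,b\},\mathcal D}{\leftrightarrow}b$ (i.e. the two-fold Palm probability $\mathbb P^{a,b}(a\overset{\Phi,\mathcal D}{\leftrightarrow}b)$) equals $$e^{-\lambda F(d_E(a,b),z,\tilde z)}\,\mathbf 1_{\{(z,\tilde z)\in\mathcal D\}}.$$
   Context: $\mathbb{H}^3=\{(x,y,z)\in\mathbb{R}^3:z>0\}$; $d_E(a,b)=\sqrt{(x-\tilde x)^2+(y-\tilde y)^2}$; $d_{\mathbb{H}^3}(a,b)=\operatorname{acosh}\big(\frac{d_E(a,b)^2}{2z\tilde z}+\frac12(\frac{z}{\tilde z}+\frac{\tilde z}{z})\big)$. $\Phi$ is a Poisson point process on $\mathbb{R}^2\times(0,\infty)$ with intensity $\lambda\,dx\,dy\,f(z)\,dz$ ($\lambda>0$, $f$ a probability density on $(0,\infty)$), i.e. a homogeneous PPP of base-station positions with i.i.d. resource marks of density $f$. $\mathcal D\subset(0,\infty)^2$ is Borel and symmetric. Nearest neighbor relation: $a\xrightarrow{\phi}b$ if $b$ is the unique minimizer of $d_{\mathbb{H}^3}(a,\cdot)$ over $\phi\setminus\{a\}$. $a\overset{\phi,\mathcal D}{\leftrightarrow}b$ (MNNR$_{\mathbb{H}^3,\mathcal D}$) means $a\xrightarrow{\phi}b$, $b\xrightarrow{\phi}a$ and $(z,\tilde z)\in\mathcal D$ where $z,\tilde z$ are the marks of $a,b$. *)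

(* Defs.v *)
From HB Require Import structures.
From mathcomp Require Import all_boot all_order all_algebra.
From mathcomp Require Import all_classical all_reals all_analysis.
Set Implicit Arguments. Unset Strict Implicit. Unset Printing Implicit Defensive.
Import Order.TTheory GRing.Theory Num.Theory.
Import numFieldNormedType.Exports.
Local Open Scope classical_set_scope.
Local Open Scope ring_scope.

Section Defs.
Variable R : realType.

Definition cosh (x : R) : R := (expR x + expR (- x)) / 2.
Definition sinh (x : R) : R := (expR x - expR (- x)) / 2.
(** acosh on [1, +oo). *)
Definition acosh (x : R) : R := ln (x + Num.sqrt (x ^+ 2 - 1)).

(** Points of R^3 are triples ((x, y), z) = (x, y, z); H^3 is z > 0. *)
Definition pt := (R * R * R)%type.

Definition dE (a b : pt) : R :=
  Num.sqrt ((a.1.1 - b.1.1) ^+ 2 + (a.1.2 - b.1.2) ^+ 2).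

Definition dH (a b : pt) : R :=
  acosh (dE a b ^+ 2 / (2 * a.2 * b.2) + 2^-1 * (a.2 / b.2 + b.2 / a.2)).

Definition nn_rel (phi : set pt) (a b : pt) : Prop :=
  [/\ phi b, b <> a &
      forall p, phi p -> p <> a -> p <> b -> dH a b < dH a p].

Definition mnn (D : set (R * R)) (phi : set pt) (a b : pt) : Prop :=
  [/\ nn_rel phi a b, nn_rel phi b a & D (a.2, b.2)].

Definition leb3 := ((@lebesgue_measure R \x @lebesgue_measure R) \x
                     @lebesgue_measure R)%E.

Definition intensity (lam : R) (f : R -> R) (B : set pt) : \bar R :=
  (lam%:E * \int[leb3]_(p in B `&` [set q : pt | (0 < q.2)%R]) (f p.2)%:E)%E.

Definition npoints (phi : set pt) (B : set pt) : \bar R :=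
  (\esum_(x in phi `&` B) 1)%E.

Definition poisson_pmf (m : R) (k : nat) : R := m ^+ k * expR (- m) / k`!%:R.

Definition is_PPP d (Omega : measurableType d) (P : probability Omega R)
    (Lam : set pt -> \bar R) (Phi : Omega -> set pt) : Prop :=
  (forall (B : set pt) (k : nat), measurable B ->
      measurable [set w | npoints (Phi w) B = k%:R%:E]) /\
  (forall (n : nat) (B : 'I_n -> set pt) (k : 'I_n -> nat),
      (forall i, measurable (B i)) ->
      (forall i, (Lam (B i) < +oo)%E) ->
      (forall i j, i <> j -> B i `&` B j = set0) ->
      P (\bigcap_(i in [set: 'I_n]) [set w | npoints (Phi w) (B i) = (k i)%:R%:E])
      = (\prod_(i < n) poisson_pmf (fine (Lam (B i))) (k i))%:E).

Definition Fpair (f : R -> R) (s z zt : R) : R :=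
  let RR := acosh (s ^+ 2 / (2 * z * zt) + 2^-1 * (z / zt + zt / z)) in
  let d := Num.sqrt (s ^+ 2 + (z - zt) ^+ 2 * cosh RR ^+ 2) in
  let r := z * sinh RR in
  let rt := zt * sinh RR in
  let c := z * cosh RR in
  let ct := zt * cosh RR in
  let h := (rt - r + d) * (r + rt - d) / (2 * d) in
  let ht := (r - rt + d) * (r + rt - d) / (2 * d) in
  let del := pi / 2 - asin ((ct - c) / d) in
  let delt := pi / 2 - asin ((c - ct) / d) in
  let mu := @lebesgue_measure R in
  pi * Rintegral mu `[- r, r] (fun w => f (w + c) * (r ^+ 2 - w ^+ 2))
  + pi * Rintegral mu `[- rt, rt] (fun w => f (w + ct) * (rt ^+ 2 - w ^+ 2))
  - Rintegral mu `[r - h, r] (fun w =>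
      Rintegral mu `[0, 2 * pi] (fun th =>
        Rintegral mu `[0, Num.sqrt (r ^+ 2 - w ^+ 2)] (fun rho =>
          f (c + w * cos del - rho * cos th * sin del) * rho)))
  - Rintegral mu `[rt - ht, rt] (fun w =>
      Rintegral mu `[0, 2 * pi] (fun th =>
        Rintegral mu `[0, Num.sqrt (rt ^+ 2 - w ^+ 2)] (fun rho =>
          f (ct + w * cos delt - rho * cos th * sin delt) * rho))).

End Defs.

(* Main.v *)
(** A point p of the process destroys the relation between a and b exactly when
    it lies in one of the closed hyperbolic balls of radius R = d(a, b) around a
    and b, so the probability is the Poisson void probability of their union.
    The hyperbolic ball of radius R around (x, y, z) is the Euclidean ball of
    centre (x, y, z cosh R) and radius z sinh R; hence the intensity of the union
    is that of two Euclidean balls minus that of their lens, and the radical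
    plane cuts the lens into two caps.  A cap integral is computed by rotating
    the axis of the cap onto a coordinate axis and passing to polar coordinates
    in the orthogonal plane.  As f is merely measurable, every change of
    variables is reduced to affine substitutions on the line and Tonelli's
    theorem. *)

Require Import Defs.
From HB Require Import structures.
From mathcomp Require Import all_boot all_order all_algebra.
From mathcomp Require Import all_classical all_reals all_analysis.
From mathcomp Require Import measurable_realfun ring lra.
Import Order.TTheory GRing.Theory Num.Theory.
Import numFieldNormedType.Exports.
Local Open Scope classical_set_scope.
Local Open Scope ring_scope.

(** [f] is only controlled on the positive half-line, so it is replaced by [g], its extension by
    zero. [Fpair] does not see the change: sinh R < cosh R keeps both Euclidean balls strictly above
    height 0. The formula [dH] also gets evaluated at points of height at most 0, where it returns
    0. Such a point always breaks the relation, so the lower half-space has to be added to the void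
    set; it carries no intensity. The nested [Rintegral]s of [Fpair] are real parts of extended
    integrals. All changes of variables are therefore carried out on nonnegative extended integrals,
    and finiteness, drawn from the integrability of [f], is used only on the way back to the reals.
    The number r - h is the signed distance from a centre to the radical plane, so a cap may exceed
    half a ball. The one inequality needed is r - h >= - r; it follows from |r - rt| <= d, which
    again comes from sinh R <= cosh R. *)

Lemma measurable_in_itv {R : realType} (i : interval R) :
  measurable_fun [set: R] (fun x => x \in i).
Proof.
by apply: (measurable_fun_bool true); rewrite setTI; exact: measurable_itv.
Qed.

(** Recursion on the head symbol of the function. A difference is tried before a sum because it is
    itself a sum with an opposite; unrecognised goals are left open. *)
Ltac mfun := lazymatch goal with
  | |- measurable_fun _ (fun _ => ?c) => exact: measurable_cst
  | |- measurable_fun _ (fun x => x) => exact: measurable_id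
  | |- measurable_fun _ (fun x => GRing.add (@?u x) (GRing.opp (@?v x))) =>
      apply: (@measurable_funB _ _ _ _ u v); mfun
  | |- measurable_fun _ (fun x => GRing.add (@?u x) (@?v x)) =>
      apply: (@measurable_funD _ _ _ _ u v); mfun
  | |- measurable_fun _ (fun x => GRing.mul (@?u x) (@?v x)) =>
      apply: (@measurable_funM _ _ _ _ u v); mfun
  | |- measurable_fun _ (fun x => GRing.opp (@?v x)) =>
      apply: (@measurable_funN _ _ _ _ v); mfun
  | |- measurable_fun _ (fun x => GRing.exp (@?v x) ?n) =>
      apply: (@measurable_funX _ _ _ _ v n); mfun
  | |- measurable_fun _ (fun x => Order.le (@?u x) (@?v x)) =>
      apply: (@measurable_fun_ler _ _ _ _ u v); mfun
  | |- measurable_fun _ (fun x => Order.lt (@?u x) (@?v x)) =>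
      apply: (@measurable_fun_ltr _ _ _ _ u v); mfun
  | |- measurable_fun _ (fun x => andb (@?u x) (@?v x)) =>
      apply: (@measurable_and _ _ _ u v); mfun
  | |- measurable_fun _ (fun x => EFin (@?u x)) =>
      apply/(@measurable_EFinP _ _ _ _ u); mfun
  | |- measurable_fun _ (fun x => mule (@?u x) (@?v x)) =>
      apply: (@emeasurable_funM _ _ _ _ u v); mfun
  | |- measurable_fun _ (fun x => fst (@?u x)) =>
      apply: (measurableT_comp measurable_fst (g := u)); mfun
  | |- measurable_fun _ (fun x => snd (@?u x)) =>
      apply: (measurableT_comp measurable_snd (g := u)); mfun
  | |- measurable_fun _ (fun x => in_mem (@?u x) (mem ?i)) =>
      apply: (measurableT_comp (measurable_in_itv i) (g := u)); mfun
  | |- measurable_fun _ (fun x => ?f (@?u x)) =>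
      first [apply: (@measurableT_comp _ _ _ _ _ _ f _ u); [by [] | mfun] | idtac]
  | |- measurable_fun _ _ =>
      first [done | apply: measurable_fun_ifT; mfun | idtac]
  | _ => idtac
  end.

(** * Affine substitutions on the line *)

Section lebesgue_affine.
Context {R : realType}.
Local Notation mu := (@lebesgue_measure R).
Local Open Scope ereal_scope.

Lemma measurable_affine (a b : R) :
  measurable_fun [set: R] (fun x : R => a * x + b)%R.
Proof. by mfun. Qed.

Let affine (a b : R) : R -> measurableTypeR R := fun x => (a * x + b)%R.

Let maffine (a b : R) : {measure set (measurableTypeR R) -> \bar R} :=
  measure_function_pushforward__canonical__measure_function_Measure
    mu (measurable_affine a b : measurable_fun setT (affine a b)).

(** The right-hand side is a measure in [A], a scaled pushforward, so by uniqueness it suffices to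
    compare both sides on half-open intervals. For negative [a] the preimage is half-open at the
    other end, with the same length. *)
Lemma lebesgue_measure_affine (a b : R) (A : set R) : a != 0%R -> measurable A ->
  mu A = `|a|%:E * mu ((fun x => a * x + b)%R @^-1` A).
Proof.
move=> a0 mA.
have na0 : (0 <= `|a|)%R by [].
pose m := mscale (NngNum na0) (maffine a b).
rewrite -[RHS]/(m A); apply: lebesgue_measure_unique => // _ [[c d] _ <-].
change (mu `]c, d]%classic = `|a|%:E * mu (affine a b @^-1` `]c, d]%classic)).
rewrite lebesgue_measure_itv/= lte_fin.
have [a_gt0|a_lt0|/eqP] := ltgtP 0%R a; last by rewrite eq_sym (negbTE a0).
- have E : affine a b @^-1` `]c, d]%classic = `]((c - b) / a)%R, ((d - b) / a)%R]%classic :> set R.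
    apply/seteqP; split => x /=; rewrite !in_itv/= /affine;
    by rewrite ltr_pdivrMr// ler_pdivlMr// ltrBlDr lerBrDr mulrC.
  rewrite E lebesgue_measure_itv/= lte_fin ltr_pM2r ?invr_gt0// ltrD2r.
  case: ifPn => _; last by rewrite mule0.
  by rewrite -!EFinD -EFinM gtr0_norm//; congr EFin; field.
- have E : affine a b @^-1` `]c, d]%classic = `[((d - b) / a)%R, ((c - b) / a)%R[%classic :> set R.
    apply/seteqP; split => x /=; rewrite !in_itv/= /affine;
    by rewrite ltr_ndivlMr// ler_ndivrMr// ltrBlDr lerBrDr mulrC andbC.
  rewrite E lebesgue_measure_itv/= lte_fin ltr_nM2r ?invr_lt0// ltrD2r.
  case: ifPn => _; last by rewrite mule0.
  by rewrite -!EFinD -EFinM ltr0_norm//; congr EFin; field.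
Qed.

Lemma ge0_integral_affine (a b : R) (h : R -> \bar R) : a != 0%R ->
  measurable_fun [set: R] h -> (forall x, 0 <= h x) ->
  \int[mu]_x h x = `|a|%:E * \int[mu]_x h (a * x + b)%R.
Proof.
move=> a0 mh h0; have na0 : (0 <= `|a|)%R by [].
transitivity (\int[mscale (NngNum na0) (maffine a b)]_x h x).
  by apply: eq_measure_integral => A mA _; exact: lebesgue_measure_affine.
rewrite ge0_integral_mscale//; congr (_ * _).
have mphi : @measurable_fun _ _ (measurableTypeR R) (measurableTypeR R) setT
  (affine a b) := measurable_affine a b.
exact: (ge0_integral_pushforward mphi mu measurableT mh (fun y _ => h0 y)).
Qed.

End lebesgue_affine.

(** * Rotations of the plane *)

Section rotation.
Context {R : realType}.
Local Notation mu := (@lebesgue_measure R).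
Local Open Scope ereal_scope.

Lemma ge0_integral_swap (h : R -> R -> \bar R) :
  measurable_fun [set: R * R] (fun p => h p.1 p.2) ->
  (forall x y, 0 <= h x y) ->
  \int[mu]_x \int[mu]_y h x y = \int[mu]_y \int[mu]_x h x y.
Proof.
move=> mh h0.
exact: (@fubini_tonelli _ _ _ _ _ mu mu (fun p => h p.1 p.2) mh (fun p => h0 _ _)).
Qed.

Lemma measurable_fun_integral2 (h : R -> R -> \bar R) :
  measurable_fun [set: R * R] (fun p => h p.1 p.2) ->
  (forall x y, 0 <= h x y) ->
  measurable_fun [set: R] (fun x => \int[mu]_y h x y).
Proof.
move=> mh h0.
exact: (@measurable_fun_fubini_tonelli_F _ _ _ _ _ mu (fun p => h p.1 p.2) mh (fun p => h0 _ _)).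
Qed.

Lemma measurable_fun_comp2 d (T : measurableType d) (h : R -> R -> \bar R)
    (u v : T -> R) :
  measurable_fun [set: R * R] (fun p => h p.1 p.2) ->
  measurable_fun setT u -> measurable_fun setT v ->
  measurable_fun setT (fun x => h (u x) (v x)).
Proof.
move=> mh mu_ mv.
exact: (measurableT_comp mh (measurable_fun_pair mu_ mv)).
Qed.

(** No Jacobian theorem is involved: for s != 0 the rotation is a composition of two one-variable
    affine substitutions. At fixed z put x = (w - z c) / s, exchange the integrals, then at fixed w
    put z = w c - y s. The factors 1 / |s| and |s| cancel, and 1 - c^2 = s^2 turns x into w s + y
    c. *)
Lemma ge0_integral_rotation (G : R -> R -> \bar R) (c s : R) :
  (c ^+ 2 + s ^+ 2 = 1)%R ->
  measurable_fun [set: R * R] (fun p => G p.1 p.2) ->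
  (forall x y, 0 <= G x y) ->
  \int[mu]_w \int[mu]_y G (w * c - y * s)%R (w * s + y * c)%R =
  \int[mu]_z \int[mu]_x G z x.
Proof.
move=> cs1 mG G0.
(* The factorisation divides by [s]. When [s] vanishes, c = 1 or c = -1, and each coordinate changes
   at most its sign. *)
have [s0|s0] := eqVneq s 0%R.
  have c0 : c != 0%R by apply/eqP => c0; move: cs1; rewrite c0 s0; lra.
  have c1 : (`|c| = 1)%R.
    have /eqP : (c ^+ 2 = 1)%R by rewrite -cs1 s0 expr0n addr0.
    by rewrite sqrf_eq1 => /orP[]/eqP->; rewrite ?normrN normr1.
  rewrite [RHS](ge0_integral_affine c 0)//; last 2 first.
  - exact: measurable_fun_integral2.
  - by move=> x; exact: integral_ge0.
  rewrite c1 mul1e; apply: eq_integral => w _.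
  rewrite [RHS](ge0_integral_affine c 0)//; last first.
    by apply: measurable_fun_comp2 => //; mfun.
  rewrite c1 mul1e; apply: eq_integral => y _.
  by rewrite s0 !mulr0 subr0 addr0 add0r mulrC (mulrC y) addr0.
have ns0 : (- s != 0)%R by rewrite oppr_eq0.
have si0 : (s^-1 != 0)%R by rewrite invr_eq0.
under [RHS]eq_integral => z _.
  rewrite (ge0_integral_affine s^-1 (- (z * c / s))%R)//; last first.
    by apply: measurable_fun_comp2 => //; mfun.
  over.
rewrite /= ge0_integralZl//; last 2 first.
- apply: measurable_fun_integral2 => //.
  by apply: measurable_fun_comp2 => //; mfun.
- by move=> x _; exact: integral_ge0.
rewrite [X in _ = _ * X]ge0_integral_swap//; last first.
  by apply: measurable_fun_comp2 => //; mfun.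
under [X in _ = _ * X]eq_integral => w _.
  rewrite (ge0_integral_affine (- s)%R (w * c)%R)//; last first.
    by apply: measurable_fun_comp2 => //; mfun.
  over.
rewrite /= ge0_integralZl//; last 2 first.
- apply: measurable_fun_integral2 => //.
  by apply: measurable_fun_comp2 => //; mfun.
- by move=> x _; exact: integral_ge0.
rewrite muleA -EFinM normrN normfV mulVf ?normr_eq0// mul1e.
apply: eq_integral => w _; apply: eq_integral => y _.
congr G; first by ring.
transitivity (w * (1 - c ^+ 2) / s + y * c)%R; last by field.
by rewrite -cs1; field.
Qed.

End rotation.

(** * Measurability and integrals of elementary functions *)

Section trigo_integral.
Context {R : realType}.
Local Notation mu := (@lebesgue_measure R).

Lemma measurable_invr (D : set R) : measurable_fun D (@GRing.inv R).
Proof.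
apply: measurable_funTS.
have -> : [set: R] = [set x | x != 0] `|` [set 0].
  by apply/seteqP; split => // x _ /=; have [->|] := eqVneq x 0; [right|left].
have o0 : open [set x : R | x != 0] by exact: open_neq.
apply/measurable_funU; [exact: open_measurable|exact: measurable_set1|split].
- by apply: open_continuous_measurable_fun => // x /[!inE] x0; exact: inv_continuous.
- exact: measurable_fun_set1.
Qed.

Lemma measurable_cos (D : set R) : measurable_fun D (@cos R).
Proof. by apply: measurable_funTS; apply: continuous_measurable_fun; exact: continuous_cos. Qed.

Lemma measurable_sqrt (D : set R) : measurable_fun D (@Num.sqrt R).
Proof. by apply: measurable_funTS; apply: continuous_measurable_fun; exact: sqrt_continuous. Qed.

Lemma integral_cosV2 (t : R) : 0 <= t < pi / 2 ->
  (\int[mu]_(x in `[0%R, t]) ((cos x) ^- 2)%:E = (tan t)%:E)%E.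
Proof.
move=> /andP[]; rewrite le_eqVlt => /predU1P[<- _|t0 tpi].
  by rewrite set_itv1 integral_set1 tan0.
have cos0 x : x \in `[0, t] -> cos x != 0.
  rewrite in_itv/= => /andP[x0 xt]; rewrite gt_eqF// cos_gt0_pihalf//.
  by rewrite (le_lt_trans xt)// andbT (lt_le_trans _ x0)// oppr_lt0 divr_gt0// pi_gt0.
have cos0' x : x \in `]0, t[ -> cos x != 0.
  by move=> /subset_itv_oo_cc; exact: cos0.
have h0 : (0 : R) \in `[0, t] by rewrite in_itv/= lexx ltW.
have ht : t \in `[0, t] by rewrite in_itv/= lexx ltW.
rewrite (@continuous_FTC2 _ _ tan)//.
- by rewrite tan0 sube0.
- apply: continuous_in_subspaceT => x /[!inE] /cos0 c0.
  apply: (@continuous_comp _ _ _ (fun x => cos x ^+ 2) GRing.inv).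
    by apply: continuousM; exact: continuous_cos.
  by apply: inv_continuous; rewrite expf_neq0.
- split.
  + by move=> x /cos0' c0; exact: derivable_tan.
  + by apply: cvg_at_right_filter; apply: continuous_tan; exact: cos0.
  + by apply: cvg_at_left_filter; apply: continuous_tan; exact: cos0.
- move=> x /cos0' c0; rewrite derive1E.
  by have /@derive_val := is_derive_tan c0.
Qed.

Lemma tan_acos (x : R) : -1 <= x <= 1 -> tan (acos x) = Num.sqrt (1 - x ^+ 2) / x.
Proof. by move=> x1; rewrite /tan sin_acos// acosK// in_itv. Qed.

End trigo_integral.

#[global] Hint Extern 0 (measurable_fun _ (@GRing.inv _)) =>
  solve [exact: measurable_invr] : core.
#[global] Hint Extern 0 (measurable_fun _ cos) =>
  solve [exact: measurable_cos] : core.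
#[global] Hint Extern 0 (measurable_fun _ (@Num.sqrt _)) =>
  solve [exact: measurable_sqrt] : core.

(** * Polar coordinates for a function of one Cartesian coordinate *)

Section polar.
Context {R : realType}.
Local Notation mu := (@lebesgue_measure R).
Local Open Scope ereal_scope.

(** Moves the domain into the integrand, so that the substitution and Tonelli lemmas, stated on the
    whole line, apply. *)
Lemma integral_itvE (i : interval R) (f : R -> \bar R) :
  \int[mu]_(x in [set` i]) f x = \int[mu]_x (if x \in i then f x else 0).
Proof.
by rewrite integral_mkcond; apply: eq_integral => x _; rewrite patchE mem_setE.
Qed.

(** Used with t = y / r: after exchanging the integrals, the angles whose ray meets the abscissa y
    inside the disk form this interval. Positivity of [t] keeps acos t below pi / 2. *)
Lemma cos_ge_acos (t x : R) : (0 < t <= 1)%R ->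
  ((0 <= x) && (x < pi / 2) && (t <= cos x) = (0 <= x <= acos t))%R.
Proof.
move=> /andP[t0 t1].
have t11 : (-1 <= t <= 1)%R by rewrite t1 andbT (le_trans _ (ltW t0))// lerN10.
have pi0 := @pi_gt0 R.
have acosI : acos t \in `[0%R, pi] by rewrite in_itv/= acos_ge0// acos_lepi.
have pihI : (pi / 2)%R \in `[0%R, (@pi R)].
  by rewrite in_itv/=; apply/andP; split; lra.
have acosE : cos (acos t) = t by rewrite acosK// in_itv.
have acos_lt : (acos t < pi / 2)%R by rewrite -ltr_cos// cos_pihalf acosE.
have [x0|//] := boolP (0 <= x)%R; rewrite /=.
have [xp|xp] := ltP x (pi / 2)%R; last first.
  by apply/esym/negbTE; rewrite -ltNge (lt_le_trans acos_lt).
have xI : x \in `[0%R, (@pi R)] by rewrite in_itv/= x0/=; lra.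
by rewrite -{1}acosE !leNgt ltr_cos.
Qed.

(* The substitution y = rho cos theta in rho is linear, so that it is valid for
   merely measurable g; the theta-integral of 1 / cos ^ 2 is then a tangent. *)
Lemma ge0_integral_polar_quarter (g : R -> R) (r : R) : (0 < r)%R ->
  measurable_fun [set: R] g -> (forall x, 0 <= g x)%R ->
  \int[mu]_(t in `[0%R, (pi / 2)%R])
     \int[mu]_(rho in `[0%R, r]) (g (rho * cos t) * rho)%:E =
  \int[mu]_(y in `]0%R, +oo[) (g y * Num.sqrt (r ^+ 2 - y ^+ 2))%:E.
Proof.
move=> r0 mg g0.
(* The integrand after y = rho cos t: rho d(rho) becomes y / cos^2 t dy, and rho <= r becomes y <= r
   cos t. *)
pose K (t y : R) : \bar R :=
  if ((0 <= t) && (t < pi / 2) && (y <= r * cos t) && (0 < y))%R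
  then (g y * (y * cos t ^- 2))%:E else 0.
have K0 t y : 0 <= K t y.
  rewrite /K; case: ifPn => // /andP[_ y0].
  by rewrite lee_fin mulr_ge0// mulr_ge0 ?invr_ge0 ?sqr_ge0// ltW.
have mK : measurable_fun [set: R * R] (fun p => K p.1 p.2) by rewrite /K; mfun.
(* The endpoint pi / 2 is dropped because the cosine vanishes there and the substitution
   degenerates. *)
rewrite -integral_itv_bndo_bndc; last first.
  apply: measurable_funTS.
  under eq_fun do rewrite integral_itvE.
  apply: measurable_fun_integral2 => [|x y].
    by mfun.
  case: ifPn => //; rewrite in_itv/= => /andP[y0 _].
  by rewrite lee_fin mulr_ge0.
transitivity (\int[mu]_t \int[mu]_y K t y).
  rewrite integral_itvE; apply: eq_integral => t _; rewrite in_itv/=.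
  case: ifPn => [/andP[t0 tpi]|tN]; last first.
    by rewrite integral0_eq// => y _; rewrite /K (negbTE tN).
  have ct0 : (0 < cos t)%R.
    by rewrite cos_gt0_pihalf// tpi andbT (lt_le_trans _ t0)// oppr_lt0 divr_gt0// pi_gt0.
  have mKt : measurable_fun [set: R] (K t) by rewrite /K; mfun.
  rewrite (ge0_integral_affine (cos t) 0 (K t))// ?gt_eqF//.
  rewrite -ge0_integralZl//; last first.
    by apply: (measurableT_comp mKt); mfun.
  rewrite integral_itvE; apply: eq_integral => x _; rewrite in_itv/=.
  rewrite /K addr0 t0 tpi/= [(cos t * x)%R]mulrC ler_pM2r// pmulr_lgt0//.
  rewrite gtr0_norm// andbC.
  have [x0|x0|<-] := ltgtP 0%R x; rewrite ?andbF ?andbT/= ?mule0//.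
    case: ifPn => _; last by rewrite mule0.
    by rewrite -EFinM; congr EFin; field; rewrite gt_eqF.
  by rewrite mulr0; case: ifPn.
rewrite ge0_integral_swap// [RHS]integral_itvE.
apply: eq_integral => y _; rewrite in_itv/= andbT.
case: ifPn => [y0|yN]; last first.
  by rewrite integral0_eq// => t _; rewrite /K (negbTE yN) andbF.
have [yr|yr] := leP y r; last first.
  rewrite ler0_sqrtr ?mulr0; last by rewrite subr_le0 lerXn2r ?nnegrE ?ltW.
  rewrite integral0_eq// => t _; rewrite /K; case: ifPn => //.
  move=> /andP[/andP[_ yt] _]; have := lt_le_trans yr yt.
  by rewrite ltNge ler_piMr ?cos_le1// ltW.
have yr1 : (0 < y / r <= 1)%R by rewrite divr_gt0//= ler_pdivrMr// mul1r.
have yr11 : (-1 <= y / r <= 1)%R by move: yr1; move=> /andP[]; lra.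
transitivity (\int[mu]_(t in `[0%R, acos (y / r)]) ((g y * y)%:E * (cos t ^- 2)%:E)).
  rewrite integral_itvE; apply: eq_integral => t _; rewrite /K y0 andbT in_itv/=.
  by rewrite -cos_ge_acos// ler_pdivrMr// [(cos t * r)%R]mulrC -EFinM mulrA.
rewrite ge0_integralZl//; last 3 first.
- by apply: measurable_funTS; mfun.
- by move=> t _; rewrite lee_fin invr_ge0 sqr_ge0.
- by rewrite lee_fin mulr_ge0// ltW.
rewrite integral_cosV2; last first.
  have : (0 <= acos (y / r) <= acos (y / r))%R by rewrite acos_ge0//=.
  by rewrite -cos_ge_acos// => /andP[].
rewrite -EFinM tan_acos// -mulrA; congr (_ * _)%:E.
have -> : (r ^+ 2 - y ^+ 2 = r ^+ 2 * (1 - (y / r) ^+ 2))%R.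
  by field; rewrite gt_eqF.
rewrite sqrtrM ?sqr_ge0// sqrtr_sqr gtr0_norm//.
by field; rewrite !gt_eqF.
Qed.

Lemma ge0_integral_itv_reflect (k a b : R) (h : R -> \bar R) :
  measurable_fun [set: R] h -> (forall x, 0 <= h x) ->
  \int[mu]_(x in `[a, b]) h x = \int[mu]_(x in `[(k - b)%R, (k - a)%R]) h (k - x)%R.
Proof.
move=> mh h0; rewrite !integral_itvE.
rewrite (ge0_integral_affine (-1)%R k) ?oppr_eq0 ?oner_eq0//; last 2 first.
- by mfun.
- by move=> x; case: ifPn.
rewrite normrN1 mul1e; apply: eq_integral => x _.
rewrite mulN1r addrC !in_itv/=.
by have -> : (a <= k - x <= b = (k - b <= x <= k - a))%R
  by apply/andP/andP => -[? ?]; split; lra.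
Qed.

Lemma ge0_integral_itv_split (a b c : R) (h : R -> \bar R) : (a <= b <= c)%R ->
  measurable_fun [set: R] h -> (forall x, 0 <= h x) ->
  \int[mu]_(x in `[a, c]) h x =
  \int[mu]_(x in `[a, b]) h x + \int[mu]_(x in `[b, c]) h x.
Proof.
move=> /andP[ab bc] mh h0.
rewrite -[X in _ = _ + X]integral_itv_obnd_cbnd; last exact: measurable_funTS.
rewrite !integral_itvE -ge0_integralD//.
- apply: eq_integral => x _; rewrite !in_itv/=.
  have [xb|xb] := leP x b; rewrite ?andbF ?andbT/=.
    by rewrite (le_trans xb bc) andbT adde0.
  by rewrite (le_trans ab (ltW xb)) add0e.
- by move=> x _; case: ifPn.
- by mfun.
- by move=> x _; case: ifPn.
- by mfun.
Qed.

(** The right-hand side slices the disk into chords of length 2 sqrt(r^2 - y^2); for |y| > r the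
    square root of a negative number is 0, so no bound on [y] is needed. The symmetries t -> 2 pi -
    t and t -> pi - t reduce the circle to a quarter, the second one replacing [g] by its
    reflection. *)
Lemma ge0_integral_polar (g : R -> R) (r : R) : (0 <= r)%R ->
  measurable_fun [set: R] g -> (forall x, 0 <= g x)%R ->
  \int[mu]_(t in `[0%R, (2 * pi)%R])
     \int[mu]_(rho in `[0%R, r]) (g (rho * cos t) * rho)%:E =
  \int[mu]_y (g y * (2 * Num.sqrt (r ^+ 2 - y ^+ 2)))%:E.
Proof.
rewrite le_eqVlt => /predU1P[<- mg g0|r0 mg g0].
  rewrite !integral0_eq// => [t _|y _]; last by rewrite set_itv1 integral_set1.
  by rewrite expr0n/= sub0r ler0_sqrtr ?oppr_le0 ?sqr_ge0// !mulr0.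
pose J t := \int[mu]_(rho in `[0%R, r]) (g (rho * cos t) * rho)%:E.
have J0 t : 0 <= J t.
  apply: integral_ge0 => x /=; rewrite in_itv/= => /andP[x0 _].
  by rewrite lee_fin mulr_ge0.
have mJ : measurable_fun [set: R] J.
  rewrite /J; under eq_fun do rewrite integral_itvE.
  apply: measurable_fun_integral2 => [|x y]; first by mfun.
  case: ifPn => //; rewrite in_itv/= => /andP[y0 _].
  by rewrite lee_fin mulr_ge0.
rewrite -/J; have pi0 := @pi_gt0 R.
rewrite (@ge0_integral_itv_split 0 pi)//; last by apply/andP; split; lra.
have -> : \int[mu]_(t in `[pi, (2 * pi)%R]) J t = \int[mu]_(t in `[0%R, pi]) J t.
  rewrite (@ge0_integral_itv_reflect (2 * pi))// subrr.
  rewrite (_ : 2 * pi - pi = pi)%R; last by ring.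
  apply: eq_integral => t _; apply: eq_integral => x _.
  by rewrite addrC mulr_natl cosD2pi cosN.
pose Q (u : R -> R) :=
  \int[mu]_(y in `]0%R, +oo[) (u y * Num.sqrt (r ^+ 2 - y ^+ 2))%:E.
have -> : \int[mu]_(t in `[0%R, pi]) J t = Q g + Q (g \o -%R).
  rewrite (@ge0_integral_itv_split 0 (pi / 2))//; last by apply/andP; split; lra.
  congr (_ + _); first exact: ge0_integral_polar_quarter.
  rewrite (@ge0_integral_itv_reflect pi)// subrr.
  rewrite (_ : pi - pi / 2 = pi / 2)%R; last by field.
  rewrite /Q -ge0_integral_polar_quarter//; last first.
    by move=> x /=.
    exact: measurableT_comp.
  apply: eq_integral => t _; apply: eq_integral => x _ /=.
  by rewrite addrC cosDpi cosN mulrN.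
pose F y := (g y * Num.sqrt (r ^+ 2 - y ^+ 2))%:E.
have F0 y : 0 <= F y by rewrite lee_fin mulr_ge0// sqrtr_ge0.
have mF : measurable_fun [set: R] F by rewrite /F; mfun.
have -> : Q g + Q (g \o -%R) = \int[mu]_y F y.
  have -> : [set: R] = `]-oo, 0%R] `|` `]0%R, +oo[.
    by rewrite -itv_bndbnd_setU// set_itvE.
  rewrite ge0_integral_setU//=; last 2 first.
  - exact: measurable_funTS.
  - by apply/disj_setPS => x [] /=; rewrite !in_itv/= andbT leNgt => /negbTE ->.
  rewrite addeC; congr (_ + _).
  rewrite /Q integral_itv_obnd_cbnd; last by apply: measurable_funTS => /=; mfun.
  rewrite ge0_integration_by_substitution0; last 2 first.
  - by rewrite /=; mfun.
  - by move=> x; rewrite lee_fin; apply: mulr_ge0; [exact: g0|exact: sqrtr_ge0].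
  by apply: eq_integral => x _; rewrite /= opprK sqrrN.
rewrite -ge0_integralD//.
by apply: eq_integral => y _; rewrite /F -EFinD; congr EFin; ring.
Qed.

End polar.

(** * Three-dimensional Lebesgue measure as an iterated integral *)

Section ball_sections.
Context {R : realType}.
Local Notation mu := (@lebesgue_measure R).
Local Open Scope ereal_scope.

Lemma sigma_finite_lebesgue2 : sigma_finite [set: R * R] (mu \x mu).
Proof.
exists (fun n : nat => `[(- n%:R)%R, n%:R]%classic `*` `[(- n%:R)%R, n%:R]%classic).
  apply/seteqP; split => // -[x y] _.
  exists (Num.truncn (Num.max `|x| `|y|)%R).+1 => //=; rewrite !in_itv/= -!ler_norml.
  have := truncnS_gt (Num.max `|x| `|y|)%R.
  by rewrite gt_max => /andP[/ltW ? /ltW ?].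
move=> n; split; first by apply: measurableX; exact: measurable_itv.
rewrite product_measure1E//= lebesgue_measure_itv/=.
by case: ifPn => _; rewrite ?mul0e// -EFinD -EFinM ltry.
Qed.

(* The library only declares a product of measures canonically sigma-finite when
   the factors are subprobabilities. *)
Let leb2 : {sigma_finite_measure set (measurableTypeR R * measurableTypeR R)%type -> \bar R} :=
  HB.pack (mu \x mu) (Measure_isSigmaFinite.Build _ _ _ (mu \x mu) sigma_finite_lebesgue2).

Lemma ge0_integral_leb3 (H : pt R -> \bar R) :
  measurable_fun [set: pt R] H -> (forall p, 0 <= H p) ->
  \int[@leb3 R]_p H p = \int[mu]_z \int[mu]_x \int[mu]_y H ((x, y), z).
Proof.
move=> mH H0.
etransitivity; first exact: (@fubini_tonelli2 _ _ _ _ _ leb2 mu H mH H0).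
apply: eq_integral => z _.
apply: (@fubini_tonelli1 _ _ _ _ _ mu mu (fun q => H (q, z))) => //.
exact: measurable_fun_pair1.
Qed.

Lemma ge0_integral_translate (b : R) (h : R -> \bar R) :
  measurable_fun [set: R] h -> (forall x, 0 <= h x) ->
  \int[mu]_x h x = \int[mu]_x h (x + b)%R.
Proof.
move=> mh h0; rewrite (ge0_integral_affine 1 b)// ?oner_eq0//.
by rewrite normr1 mul1e; apply: eq_integral => x _; rewrite mul1r.
Qed.

Lemma integral_chord (D k : R) : (0 <= k)%R ->
  \int[mu]_y (if (y ^+ 2 <= D)%R then k%:E else 0) = (k * (2 * Num.sqrt D))%:E.
Proof.
move=> k0; have [D0|D0] := leP 0%R D; last first.
  rewrite ler0_sqrtr ?ltW// !mulr0 integral0_eq// => y _.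
  by rewrite leNgt (lt_le_trans D0 (sqr_ge0 _)).
transitivity (\int[mu]_(y in `[(- Num.sqrt D)%R, Num.sqrt D]) (cst k%:E) y).
  rewrite integral_itvE; apply: eq_integral => y _; rewrite in_itv/=.
  by rewrite -ler_norml -sqrtr_sqr ler_sqrt.
rewrite integral_cst//= lebesgue_measure_itv/= lte_fin.
have := sqrtr_ge0 D; rewrite le_eqVlt => /predU1P[<-|s0].
  by rewrite oppr0 ltxx mule0 !mulr0.
rewrite (lt_trans _ s0) ?oppr_lt0// -EFinD -EFinM; congr EFin; ring.
Qed.

End ball_sections.

(** [leb3] is a plain definition; copying the structure of its body lets the measure lemmas apply to
    the name itself. *)
HB.instance Definition _ (R : realType) := Measure.copy (@leb3 R)
  ((@lebesgue_measure R \x @lebesgue_measure R) \x @lebesgue_measure R)%E.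

(** * Balls sliced orthogonally to an arbitrary axis *)

Section ball_cap.
Context {R : realType}.
Local Notation mu := (@lebesgue_measure R).
Local Open Scope ereal_scope.

Definition ball3 (q : pt R) (r : R) : set (pt R) :=
  [set p | ((p.1.1 - q.1.1) ^+ 2 + (p.1.2 - q.1.2) ^+ 2 + (p.2 - q.2) ^+ 2
            <= r ^+ 2)%R].

(* The coordinate of p - q along the unit vector (ux sd, uy sd, cd). *)
Definition axial (q : pt R) (ux uy cd sd : R) (p : pt R) : R :=
  (((p.1.1 - q.1.1) * ux + (p.1.2 - q.1.2) * uy) * sd + (p.2 - q.2) * cd)%R.

Lemma measurable_ball3 q r : measurable (ball3 q r).
Proof.
have -> : ball3 q r = (fun p : pt R => (p.1.1 - q.1.1) ^+ 2 + (p.1.2 - q.1.2) ^+ 2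
    + (p.2 - q.2) ^+ 2 <= r ^+ 2)%R @^-1` [set true] by [].
rewrite -[X in measurable X]setTI.
suff /(_ measurableT [set true] I) : measurable_fun [set: pt R] (fun p : pt R =>
  (p.1.1 - q.1.1) ^+ 2 + (p.1.2 - q.1.2) ^+ 2 + (p.2 - q.2) ^+ 2 <= r ^+ 2)%R by [].
by mfun.
Qed.

Lemma measurable_axial q ux uy cd sd :
  measurable_fun [set: pt R] (axial q ux uy cd sd).
Proof. by rewrite /axial; mfun. Qed.

(** Two plane rotations bring the axis to a coordinate axis: one in the horizontal plane, one in the
    vertical plane containing the axis. Between them the horizontal direction orthogonal to the axis
    is integrated out, since neither [g] nor [T] depends on it. A general predicate [T] covers full
    balls and both kinds of cap. *)
Lemma ge0_integral_ball_slab (g : R -> R) (T : R -> bool) (q : pt R)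
    (ux uy cd sd r : R) :
  (0 <= r)%R -> (ux ^+ 2 + uy ^+ 2 = 1)%R -> (cd ^+ 2 + sd ^+ 2 = 1)%R ->
  measurable_fun [set: R] g -> (forall x, 0 <= g x)%R ->
  measurable_fun [set: R] T ->
  \int[@leb3 R]_(p in ball3 q r `&` [set p | T (axial q ux uy cd sd p)]) (g p.2)%:E =
  \int[mu]_w (if (- r <= w <= r)%R && T w then
    \int[mu]_(t in `[0%R, (2 * pi)%R])
      \int[mu]_(rho in `[0%R, Num.sqrt (r ^+ 2 - w ^+ 2)])
        (g (q.2 + w * cd - rho * cos t * sd) * rho)%:E
  else 0).
Proof.
case: q => -[x0 y0] c r0 u1 d1 mg g0 mT; rewrite /ball3 /axial/=.
rewrite integral_mkcond.
transitivity (\int[@leb3 R]_p (if ((p.1.1 - x0) ^+ 2 + (p.1.2 - y0) ^+ 2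
     + (p.2 - c) ^+ 2 <= r ^+ 2)%R &&
   T (((p.1.1 - x0) * ux + (p.1.2 - y0) * uy) * sd + (p.2 - c) * cd)%R
   then (g p.2)%:E else 0)).
  apply: eq_integral => p _; rewrite patchE.
  by congr (if _ then _ else _); apply/idP/idP => [/set_mem[/= -> ->]//|
    /andP[h1 h2]]; apply/mem_set.
rewrite ge0_integral_leb3; last 2 first.
- by mfun.
- by move=> p; case: ifPn => // _; rewrite lee_fin.
transitivity (\int[mu]_z \int[mu]_x
    (if T (x * sd + (z - c) * cd)%R
     then (g z * (2 * Num.sqrt (r ^+ 2 - (z - c) ^+ 2 - x ^+ 2)))%:E else 0)).
  apply: eq_integral => z _ /=.
  pose K (x y : R) : \bar R :=
    if (x ^+ 2 + y ^+ 2 + (z - c) ^+ 2 <= r ^+ 2)%R &&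
       T ((x * ux + y * uy) * sd + (z - c) * cd)%R then (g z)%:E else 0.
  have K0 x y : 0 <= K x y by rewrite /K; case: ifPn => // _; rewrite lee_fin.
  have mK : measurable_fun [set: R * R] (fun p => K p.1 p.2) by rewrite /K; mfun.
  transitivity (\int[mu]_x \int[mu]_y K (x - x0)%R (y - y0)%R); first by [].
  rewrite (ge0_integral_translate x0); last 2 first.
  - apply: measurable_fun_integral2 => //.
    by apply: measurable_fun_comp2 => //; mfun.
  - by move=> x; exact: integral_ge0.
  transitivity (\int[mu]_x \int[mu]_y K x y).
    apply: eq_integral => x _; rewrite addrK.
    rewrite (ge0_integral_translate y0)//; last first.
      by apply: measurable_fun_comp2 => //; mfun.
    by apply: eq_integral => y _; rewrite addrK.
  (* The horizontal part of the axis becomes the first coordinate; [y] then runs over a chord on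
     which the integrand is constant. *)
  rewrite -(ge0_integral_rotation _ _ _ u1)//; apply: eq_integral => x _.
  have Kr y : K (x * ux - y * uy)%R (x * uy + y * ux)%R =
      if T (x * sd + (z - c) * cd)%R then
        (if (y ^+ 2 <= r ^+ 2 - (z - c) ^+ 2 - x ^+ 2)%R then (g z)%:E else 0) else 0.
    rewrite /K.
    have -> : ((x * ux - y * uy) ^+ 2 + (x * uy + y * ux) ^+ 2 = x ^+ 2 + y ^+ 2)%R.
      transitivity ((ux ^+ 2 + uy ^+ 2) * (x ^+ 2 + y ^+ 2))%R; first by ring.
      by rewrite u1 mul1r.
    have -> : ((x * ux - y * uy) * ux + (x * uy + y * ux) * uy = x)%R.
      transitivity ((ux ^+ 2 + uy ^+ 2) * x)%R; first by ring.
      by rewrite u1 mul1r.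
    have -> : (x ^+ 2 + y ^+ 2 + (z - c) ^+ 2 <= r ^+ 2 =
               (y ^+ 2 <= r ^+ 2 - (z - c) ^+ 2 - x ^+ 2))%R.
      by apply/idP/idP => ?; lra.
    by case: (T _); rewrite ?andbT ?andbF.
  under eq_integral do rewrite Kr.
  case: ifPn => _; last by rewrite integral0.
  exact: integral_chord.
pose G (z x : R) : \bar R := if T (x * sd + z * cd)%R
  then (g (z + c) * (2 * Num.sqrt (r ^+ 2 - z ^+ 2 - x ^+ 2)))%:E else 0.
have G0 z x : 0 <= G z x.
  by rewrite /G; case: ifPn => // _; rewrite lee_fin !mulr_ge0// sqrtr_ge0.
have mG : measurable_fun [set: R * R] (fun p => G p.1 p.2) by rewrite /G; mfun.
rewrite (ge0_integral_translate c); last 2 first.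
- apply: measurable_fun_integral2 => [|z x]; first by mfun.
  by case: ifPn => // _; rewrite lee_fin !mulr_ge0// sqrtr_ge0.
- move=> z; apply: integral_ge0 => x _.
  by case: ifPn => // _; rewrite lee_fin !mulr_ge0// sqrtr_ge0.
transitivity (\int[mu]_z \int[mu]_x G z x).
  apply: eq_integral => z _; apply: eq_integral => x _.
  by rewrite /G addrK.
(* Now [w] is the axial coordinate, and the weight left in [y] is the chord length in the disk of
   radius sqrt(r^2 - w^2). *)
rewrite -(ge0_integral_rotation _ _ _ d1)//; apply: eq_integral => w _.
have Gr y : G (w * cd - y * sd)%R (w * sd + y * cd)%R =
    if T w then (g (c + w * cd - y * sd) *
      (2 * Num.sqrt (r ^+ 2 - w ^+ 2 - y ^+ 2)))%:E else 0.
  rewrite /G.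
  have -> : ((w * sd + y * cd) * sd + (w * cd - y * sd) * cd = w)%R.
    transitivity ((cd ^+ 2 + sd ^+ 2) * w)%R; first by ring.
    by rewrite d1 mul1r.
  have -> : (r ^+ 2 - (w * cd - y * sd) ^+ 2 - (w * sd + y * cd) ^+ 2 =
             r ^+ 2 - w ^+ 2 - y ^+ 2)%R.
    transitivity (r ^+ 2 - (cd ^+ 2 + sd ^+ 2) * (w ^+ 2 + y ^+ 2))%R; first by ring.
    by rewrite d1; ring.
  by have -> : (w * cd - y * sd + c = c + w * cd - y * sd)%R by ring.
under eq_integral do rewrite Gr.
have [Tw|Tw] := boolP (T w); last by rewrite andbF integral0.
have wrE : (`|w| <= r)%R = (w ^+ 2 <= r ^+ 2)%R.
  by rewrite -(ler_sqrt _ (sqr_ge0 r)) !sqrtr_sqr (ger0_norm r0).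
rewrite andbT -ler_norml wrE; case: ifPn => wr.
  (* This turns the polar double integral of the goal into the same chord integral. *)
  rewrite (@ge0_integral_polar _ (fun y => g (c + w * cd - y * sd)%R)) ?sqrtr_ge0//; last by mfun.
  by rewrite sqr_sqrtr// subr_ge0.
rewrite integral0_eq// => y _; rewrite ler0_sqrtr ?mulr0//.
by move: wr; rewrite -ltNge; have := sqr_ge0 y; lra.
Qed.

End ball_cap.

(** * Passing from extended to real integrals *)

Section cap_integrals.
Context {R : realType}.
Local Notation mu := (@lebesgue_measure R).
Local Open Scope ereal_scope.

(** [fine] sends +oo to 0, but a finite integral confines the value +oo to a null set. This removes
    one layer of a nested [Rintegral]. *)
Lemma Rintegral_fine d (T : measurableType d) (m : {measure set T -> \bar R})
    (D : set T) (h : T -> \bar R) :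
  measurable D -> measurable_fun D h -> (forall x, D x -> 0 <= h x) ->
  \int[m]_(x in D) h x < +oo ->
  Rintegral m D (fine \o h) = fine (\int[m]_(x in D) h x).
Proof.
move=> mD mh h0 hoo; rewrite /Rintegral; congr fine.
have ih : m.-integrable D h.
  apply/integrableP; split => //.
  by under eq_integral => x /[!inE] /h0 hx do rewrite gee0_abs//.
apply: ae_eq_integral => //.
  by apply/measurable_EFinP; apply: measurableT_comp.
by apply: filterS (integrable_ae mD ih) => x /[apply] /fineK.
Qed.

Lemma integral_disk_cst (k r : R) : (0 <= k)%R -> (0 <= r)%R ->
  \int[mu]_(t in `[0%R, (2 * pi)%R]) \int[mu]_(rho in `[0%R, r]) (k * rho)%:E =
  (pi * (k * r ^+ 2))%:E.
Proof.
move=> k0; have pi0 := @pi_gt0 R; rewrite le_eqVlt => /predU1P[<-|r0].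
  rewrite set_itv1; under eq_integral do rewrite integral_set1.
  by rewrite integral0 expr0n !mulr0.
have -> : \int[mu]_(rho in `[0%R, r]) (k * rho)%:E = (k * r ^+ 2 / 2)%:E.
  have dF (x : R) : is_derive x 1%R (fun x : R => k * x ^+ 2 / 2)%R (k * x)%R.
    by apply: is_derive_eq; rewrite /GRing.scale/= !mulr0 add0r mulr1; field.
  have cF : continuous (fun x : R => k * x ^+ 2 / 2)%R.
    move=> x; apply: cvgM; last exact: cvg_cst.
    by apply: cvgM; [exact: cvg_cst|exact: exprn_continuous].
  transitivity ((k * r ^+ 2 / 2)%:E - (k * 0 ^+ 2 / 2)%:E); last first.
    by rewrite expr0n/= mulr0 mul0r sube0.
  apply: (@continuous_FTC2 _ (fun x => k * x)%R (fun x => k * x ^+ 2 / 2)%R) => //.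
  - apply: continuous_in_subspaceT => x _.
    by apply: continuousM; [exact: cvg_cst|exact: cvg_id].
  - split.
    + by move=> x _.
    + by apply: cvg_at_right_filter; exact: cF.
    + by apply: cvg_at_left_filter; exact: cF.
  - by move=> x _; rewrite derive1E derive_val.
rewrite integral_cst//= lebesgue_measure_itv/= lte_fin pmulr_lgt0// ltr0n/=.
by rewrite -EFinD -EFinM; congr EFin; field.
Qed.

End cap_integrals.

(** * Ball and cap integrals in real form *)

Section cap_Rintegral.
Context {R : realType}.
Local Notation mu := (@lebesgue_measure R).
Variable g : R -> R.
Hypothesis mg : measurable_fun [set: R] g.
Hypothesis g0 : forall x, (0 <= g x)%R.
Hypothesis gfin : (\int[mu]_x (g x)%:E < +oo)%E.
Local Open Scope ereal_scope.

Let disk (k s r : R) := \int[mu]_(t in `[0%R, (2 * pi)%R])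
  \int[mu]_(rho in `[0%R, r]) (g (k - rho * cos t * s) * rho)%:E.

(** Chords have length at most 2 r, so the integral is at most 2 r / |s| times that of [g]. This
    bound is lost for s = 0, but then the integrand is constant on the disk apart from the factor
    rho. *)
Let disk_lty (k s r : R) : (0 <= r)%R -> disk k s r < +oo.
Proof.
move=> r0; rewrite /disk; have [->|s0] := eqVneq s 0%R.
  under eq_integral do under eq_integral do rewrite mulr0.
  by rewrite integral_disk_cst// ltry.
rewrite (@ge0_integral_polar _ (fun y => g (k - y * s)%R))//; last by mfun.
apply: (@le_lt_trans _ _ (\int[mu]_y ((2 * r)%:E * (g (k - y * s))%:E))).
  apply: ge0_le_integral => //.
  - by move=> y _; rewrite lee_fin !mulr_ge0// sqrtr_ge0.
  - by mfun.
  - by mfun.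
  - move=> y _; rewrite -EFinM lee_fin mulrC ler_wpM2r// ler_wpM2l//.
    rewrite -[leRHS](ger0_norm r0) -sqrtr_sqr ler_wsqrtr// lerBlDr lerDl.
    exact: sqr_ge0.
rewrite ge0_integralZl//; last 3 first.
- by mfun.
- by move=> y _; rewrite lee_fin.
- by rewrite lee_fin mulr_ge0.
have ns0 : (- s != 0)%R by rewrite oppr_eq0.
have mgE : measurable_fun [set: R] (fun x => (g x)%:E) by mfun.
have gE0 x : 0 <= (g x)%:E by rewrite lee_fin.
have := gfin; rewrite (ge0_integral_affine _ k _ ns0 mgE gE0).
rewrite (_ : (fun x => _) = (fun y => (g (k - y * s))%:E)); last first.
  by apply/funext => y; congr ((g _)%:E); ring.
have I0 : 0 <= \int[mu]_y (g (k - y * s))%:E.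
  by apply: integral_ge0 => y _; rewrite lee_fin.
case: (\int[mu]_y _) I0 => [x|_|//]; first by rewrite -!EFinM !ltry.
by rewrite gt0_muley ?lte_fin ?normrN ?normr_gt0// ltxx.
Qed.

Let disk_Rintegral (k s r : R) : (0 <= r)%R ->
  Rintegral mu `[0%R, (2 * pi)%R] (fun t =>
    Rintegral mu `[0%R, r] (fun rho => g (k - rho * cos t * s) * rho)%R)
  = fine (disk k s r).
Proof.
move=> r0; apply: Rintegral_fine => //; last exact: disk_lty.
- apply: measurable_funTS.
  under eq_fun do rewrite integral_itvE.
  apply: measurable_fun_integral2 => [|x y]; first by mfun.
  case: ifPn => //; rewrite in_itv/= => /andP[y0 _].
  by rewrite lee_fin mulr_ge0.
- move=> t _; apply: integral_ge0 => x /=; rewrite in_itv/= => /andP[x0 _].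
  by rewrite lee_fin mulr_ge0.
Qed.

(** The vertical axis (cd = 1, sd = 0) with a trivial predicate: [g] is constant on each slice,
    which contributes its area pi (r^2 - w^2). *)
Lemma integral_ball3 (q : pt R) (r : R) : (0 <= r)%R ->
  \int[@leb3 R]_(p in ball3 q r) (g p.2)%:E =
  (pi * Rintegral mu `[(- r)%R, r] (fun w => g (w + q.2) * (r ^+ 2 - w ^+ 2))%R)%:E.
Proof.
move=> r0.
have e1 : (1 ^+ 2 + 0 ^+ 2 = 1 :> R)%R by rewrite expr1n expr0n addr0.
have mT : measurable_fun [set: R] (fun=> true) by exact: measurable_cst.
transitivity (\int[@leb3 R]_(p in ball3 q r `&` [set p | (fun=> true) (axial q 1 0 1 0 p)])
    (g p.2)%:E).
  by congr (integral _ _ _); apply/seteqP; split => [p|p []].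
rewrite (ge0_integral_ball_slab g (fun=> true) q 1 0 1 0 r r0 e1 e1 mg g0 mT).
have h0 w : (w \in `[(- r)%R, r]) -> (0 <= g (w + q.2) * (r ^+ 2 - w ^+ 2))%R.
  rewrite in_itv/= => /andP[w1 w2]; rewrite mulr_ge0// subr_ge0.
  by rewrite -ler_sqrt ?sqr_ge0// !sqrtr_sqr (ger0_norm r0) ler_norml w1.
transitivity (\int[mu]_(w in `[(- r)%R, r])
    (pi%:E * (g (w + q.2) * (r ^+ 2 - w ^+ 2))%:E)).
  rewrite [RHS]integral_itvE; apply: eq_integral => w _.
  rewrite andbT in_itv/=; case: ifPn => // wr.
  under eq_integral do under eq_integral do rewrite mulr0 subr0 mulr1 addrC.
  rewrite integral_disk_cst ?sqrtr_ge0// sqr_sqrtr//.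
  by have /andP[? ?] := wr; rewrite subr_ge0 -ler_sqrt ?sqr_ge0// !sqrtr_sqr (ger0_norm r0) ler_norml.
have pi0 := @pi_gt0 R.
have mh : measurable_fun [set: R] (fun w => (g (w + q.2) * (r ^+ 2 - w ^+ 2))%:E).
  by mfun.
rewrite ge0_integralZl ?lee_fin ?(ltW pi0)//; last exact: measurable_funTS.
rewrite EFinM /Rintegral fineK// ge0_fin_numE; last first.
  by apply: integral_ge0 => w /= /h0; rewrite lee_fin.
apply: (@le_lt_trans _ _ (\int[mu]_w ((r ^+ 2)%:E * (g (w + q.2))%:E))).
  rewrite integral_itvE; apply: ge0_le_integral => //.
  - by move=> w _; case: ifPn => // /h0; rewrite lee_fin.
  - by mfun.
  - by mfun.
  - move=> w _; case: ifPn => _; last by rewrite -EFinM lee_fin mulr_ge0// sqr_ge0.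
    by rewrite -EFinM lee_fin mulrC ler_wpM2r// lerBlDr lerDl sqr_ge0.
rewrite ge0_integralZl//; last 3 first.
- by mfun.
- by move=> y _; rewrite lee_fin.
- by rewrite lee_fin sqr_ge0.
have mgE : measurable_fun [set: R] (fun x => (g x)%:E) by mfun.
have gE0 x : 0 <= (g x)%:E by rewrite lee_fin.
rewrite -(ge0_integral_translate q.2 _ mgE gE0).
by rewrite lte_mul_pinfty// ?lee_fin ?sqr_ge0// fin_numE.
Qed.

(** The boolean decides whether the cutting plane belongs to the cap, so that two caps can later
    partition a lens exactly. The bound - r <= t makes the lower limit of the ball redundant. *)
Lemma integral_cap3 (q : pt R) (ux uy cd sd r t : R) (b : bool) :
  (0 <= r)%R -> (ux ^+ 2 + uy ^+ 2 = 1)%R -> (cd ^+ 2 + sd ^+ 2 = 1)%R ->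
  (- r <= t)%R ->
  \int[@leb3 R]_(p in ball3 q r `&`
      [set p | axial q ux uy cd sd p \in Interval (BSide b t) +oo%O]) (g p.2)%:E =
  (Rintegral mu `[t, r] (fun w =>
    Rintegral mu `[0%R, (2 * pi)%R] (fun th =>
      Rintegral mu `[0%R, Num.sqrt (r ^+ 2 - w ^+ 2)] (fun rho =>
        g (q.2 + w * cd - rho * cos th * sd) * rho))))%:E.
Proof.
move=> r0 u1 d1 rt.
set T := fun w : R => w \in Interval (BSide b t) +oo%O.
have mT : measurable_fun [set: R] T by rewrite /T; mfun.
pose A w := disk (q.2 + w * cd) sd (Num.sqrt (r ^+ 2 - w ^+ 2)).
have A0 w : 0 <= A w.
  apply: integral_ge0 => x _; apply: integral_ge0 => y /=.
  by rewrite in_itv/= => /andP[y0 _]; rewrite lee_fin mulr_ge0.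
have AE w : A w = \int[mu]_y (g (q.2 + w * cd - y * sd) *
    (2 * Num.sqrt (Num.sqrt (r ^+ 2 - w ^+ 2) ^+ 2 - y ^+ 2)))%:E.
  rewrite /A /disk.
  by rewrite (@ge0_integral_polar _ (fun y => g (q.2 + w * cd - y * sd)%R)) ?sqrtr_ge0//; mfun.
have mA : measurable_fun [set: R] A.
  rewrite (funext AE); apply: measurable_fun_integral2 => [|x y]; first by mfun.
  by rewrite lee_fin !mulr_ge0// sqrtr_ge0.
have mS : measurable (ball3 q r `&` [set p | T (axial q ux uy cd sd p)]).
  apply: measurableI; first exact: measurable_ball3.
  rewrite -[X in measurable X]setTI.
  exact: (measurableT_comp mT (measurable_axial q ux uy cd sd) measurableT (I : measurable [set true])).
set C := LHS.
have C0 : 0 <= C by apply: integral_ge0 => p _; rewrite lee_fin.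
(* The cap lies in the ball, whose integral has just been shown to be a real number. *)
have Cfin : C < +oo.
  apply: (@le_lt_trans _ _ (\int[@leb3 R]_(p in ball3 q r) (g p.2)%:E)).
    have mB := measurable_ball3 q r.
    have mgp : measurable_fun (ball3 q r) (fun p => (g p.2)%:E).
      by apply: measurable_funTS; mfun.
    by apply: (@ge0_subset_integral _ _ R (@leb3 R) _ _ mS mB _ mgp) => [p _|p []//]; rewrite lee_fin.
  by rewrite integral_ball3// ltry.
have CE : C = \int[mu]_(w in `[t, r]) A w.
  rewrite /C (ge0_integral_ball_slab g T q _ _ _ _ _ r0 u1 d1 mg g0 mT).
  transitivity (\int[mu]_(w in [set` Interval (BSide b t) (BRight r)]) A w).
    rewrite integral_itvE; apply: eq_integral => w _.
    congr (if _ then _ else _); rewrite /T.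
    by case: (b); rewrite !in_itv/= andbT; apply/andP/andP => -[]; [
      move=> /andP[_ ?] ?|move=> ? ?|move=> /andP[_ ?] ?|move=> ? ?];
      split => //; apply/andP; split; lra.
  case: b @T mT mS @C C0 Cfin => // *.
  by rewrite integral_itv_obnd_cbnd//; exact: measurable_funTS.
transitivity (Rintegral mu `[t, r] (fine \o A))%:E; last first.
  congr EFin; apply: eq_Rintegral => w _.
  by rewrite disk_Rintegral ?sqrtr_ge0.
rewrite Rintegral_fine//; last 2 first.
- exact: measurable_funTS.
- by rewrite -CE.
by rewrite -CE fineK// ge0_fin_numE.
Qed.

End cap_Rintegral.

(** * The union of two Euclidean balls *)

Section two_balls.
Context {R : realType}.
Local Notation mu := (@lebesgue_measure R).
Variable g : R -> R.
Hypothesis mg : measurable_fun [set: R] g.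
Hypothesis g0 : forall x, (0 <= g x)%R.
Hypothesis gfin : (\int[mu]_x (g x)%:E < +oo)%E.

Definition ball_Rint (c r : R) : R :=
  pi * Rintegral mu `[- r, r] (fun w => g (w + c) * (r ^+ 2 - w ^+ 2)).

Definition cap_Rint (c r cd sd t : R) : R :=
  Rintegral mu `[t, r] (fun w =>
    Rintegral mu `[0, 2 * pi] (fun th =>
      Rintegral mu `[0, Num.sqrt (r ^+ 2 - w ^+ 2)] (fun rho =>
        g (c + w * cd - rho * cos th * sd) * rho))).

Variables (q1 q2 : pt R) (r1 r2 ux uy s d : R).
Hypothesis r1_ge0 : 0 <= r1.
Hypothesis r2_ge0 : 0 <= r2.
Hypothesis u1 : ux ^+ 2 + uy ^+ 2 = 1.
Hypothesis uxE : ux * s = q2.1.1 - q1.1.1.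
Hypothesis uyE : uy * s = q2.1.2 - q1.1.2.
Hypothesis d_gt0 : 0 < d.
Hypothesis d2E : d ^+ 2 = s ^+ 2 + (q2.2 - q1.2) ^+ 2.
(** Neither ball lies in the interior of the other. *)
Hypothesis dr : (r1 - r2) ^+ 2 <= d ^+ 2.

(** The unit vector from [q1] to [q2] is (ux sd, uy sd, cd), and [t1], [t2] are the signed distances
    from the centres to the radical plane, each measured towards the other centre. For [w2] the axis
    is reversed through [ux], [uy], [cd] while [sd] is kept, because both angles of [Fpair] have the
    same sine s / d. *)
Let cd := (q2.2 - q1.2) / d.
Let sd := s / d.
Let t1 := (d ^+ 2 + r1 ^+ 2 - r2 ^+ 2) / (2 * d).
Let t2 := (d ^+ 2 + r2 ^+ 2 - r1 ^+ 2) / (2 * d).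
Let w1 := axial q1 ux uy cd sd.
Let w2 := axial q2 (- ux) (- uy) (- cd) sd.

Let d_neq0 : d != 0. Proof. by rewrite gt_eqF. Qed.

Let cd_sd : cd ^+ 2 + sd ^+ 2 = 1.
Proof.
rewrite /cd /sd !expr_div_n -mulrDl addrC -d2E divff//.
by rewrite expf_neq0.
Qed.

Let w12 p : w1 p + w2 p = d.
Proof.
have -> : w1 p + w2 p = ((ux * s) * (q2.1.1 - q1.1.1) + (uy * s) * (q2.1.2 - q1.1.2)
    + (q2.2 - q1.2) ^+ 2) / d.
  by rewrite /w1 /w2 /axial /cd /sd; field.
rewrite -uxE -uyE.
have -> : ux * s * (ux * s) + uy * s * (uy * s) = (ux ^+ 2 + uy ^+ 2) * s ^+ 2 by ring.
by rewrite u1 mul1r -d2E expr2 mulfK.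
Qed.

(* Twice d times the height over the radical plane is the difference of powers. *)
Let power_difference p :
  (p.1.1 - q2.1.1) ^+ 2 + (p.1.2 - q2.1.2) ^+ 2 + (p.2 - q2.2) ^+ 2 - r2 ^+ 2 =
  (p.1.1 - q1.1.1) ^+ 2 + (p.1.2 - q1.1.2) ^+ 2 + (p.2 - q1.2) ^+ 2 - r1 ^+ 2
  - 2 * d * (w1 p - t1).
Proof.
have -> : 2 * d * (w1 p - t1) = 2 * ((p.1.1 - q1.1.1) * (ux * s)
    + (p.1.2 - q1.1.2) * (uy * s) + (p.2 - q1.2) * (q2.2 - q1.2))
    - (d ^+ 2 + r1 ^+ 2 - r2 ^+ 2).
  by rewrite /w1 /t1 /axial /cd /sd; field.
have -> : d ^+ 2 = (q2.1.1 - q1.1.1) ^+ 2 + (q2.1.2 - q1.1.2) ^+ 2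
    + (q2.2 - q1.2) ^+ 2.
  rewrite -uxE -uyE d2E -[in LHS](mul1r (s ^+ 2)) -u1; ring.
by rewrite uxE uyE; ring.
Qed.

Let t12 : t1 + t2 = d.
Proof. by rewrite /t1 /t2; field. Qed.

Let r12_le : - d <= r1 - r2 <= d.
Proof.
rewrite -ler_norml; move: dr.
by rewrite -(ler_sqrt _ (sqr_ge0 d)) !sqrtr_sqr (gtr0_norm d_gt0).
Qed.

(** After clearing 2 d this reads (d + r1)^2 >= r2^2, a product of two nonnegative factors by
    [r12_le]. *)
Let t1_ge : - r1 <= t1.
Proof.
rewrite /t1 ler_pdivlMr ?mulr_gt0//.
have /andP[? ?] := r12_le; have := r1_ge0; have := r2_ge0; have := d_gt0.
move=> ? ? ?; have : 0 <= (d + r1 - r2) * (d + r1 + r2) by rewrite mulr_ge0//; lra.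
lra.
Qed.

Let t2_ge : - r2 <= t2.
Proof.
rewrite /t2 ler_pdivlMr ?mulr_gt0//.
have /andP[? ?] := r12_le; have := r1_ge0; have := r2_ge0; have := d_gt0.
move=> ? ? ?; have : 0 <= (d + r2 - r1) * (d + r1 + r2) by rewrite mulr_ge0//; lra.
lra.
Qed.

Let K1 := ball3 q1 r1.
Let K2 := ball3 q2 r2.
Let cap1 := K1 `&` [set p | w1 p \in `[t1, +oo[].
Let cap2 := K2 `&` [set p | w2 p \in `]t2, +oo[].

(** Beyond the radical plane as seen from [q1], the power with respect to [q2] is the smaller one,
    so there membership in [K1] implies membership in [K2]; on the other side the roles are
    exchanged. *)
Let lensE : K1 `&` K2 = cap1 `|` cap2.
Proof.
apply/seteqP; split => p.
  case=> k1 k2; have [tw|tw] := leP t1 (w1 p).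
    by left; split => //=; rewrite in_itv/= tw.
  right; split => //=; rewrite in_itv/= andbT.
  by have := w12 p; have := t12; lra.
have pd := power_difference p.
case=> -[]; rewrite /K1 /K2 /ball3/= in_itv/= andbT => kp tw.
  split => //.
  have : 0 <= d * (w1 p - t1) by rewrite mulr_ge0 ?subr_ge0// ltW.
  by move: pd kp; lra.
split => //.
have : 0 <= d * (t1 - w1 p).
  by rewrite mulr_ge0 ?ltW//; have := w12 p; have := t12; lra.
by move: pd kp; lra.
Qed.

Let mK1 : measurable K1. Proof. exact: measurable_ball3. Qed.
Let mK2 : measurable K2. Proof. exact: measurable_ball3. Qed.

Let measurable_half (q : pt R) (vx vy vc vs : R) (i : interval R) :
  measurable [set p | axial q vx vy vc vs p \in i].
Proof.
rewrite -[X in measurable X]setTI.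
exact: (measurableT_comp (measurable_in_itv i) (measurable_axial q vx vy vc vs)
  measurableT (I : measurable [set true])).
Qed.

Let mcap1 : measurable cap1.
Proof. by apply: measurableI => //; exact: measurable_half. Qed.
Let mcap2 : measurable cap2.
Proof. by apply: measurableI => //; exact: measurable_half. Qed.

Lemma integral_two_balls :
  (\int[@leb3 R]_(p in K1 `|` K2) (g p.2)%:E =
   (ball_Rint q1.2 r1 + ball_Rint q2.2 r2 - cap_Rint q1.2 r1 cd sd t1
    - cap_Rint q2.2 r2 (- cd) sd t2)%:E)%E.
Proof.
have mgp (D : set (pt R)) : measurable_fun D (fun p : pt R => (g p.2)%:E).
  by apply: measurable_funTS; mfun.
have gp0 (D : set (pt R)) (p : pt R) : D p -> (0 <= (g p.2)%:E)%E.
  by rewrite lee_fin.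
have split_int (A B : set (pt R)) : measurable A -> measurable B ->
    [disjoint A & B] -> (\int[@leb3 R]_(p in A `|` B) (g p.2)%:E =
    \int[@leb3 R]_(p in A) (g p.2)%:E + \int[@leb3 R]_(p in B) (g p.2)%:E)%E.
  move=> mA mB AB.
  exact: (@ge0_integral_setU _ _ R (@leb3 R) A B mA mB _ (mgp _) (gp0 _) AB).
have nu1 : (- ux) ^+ 2 + (- uy) ^+ 2 = 1 by rewrite !sqrrN.
have ncd : (- cd) ^+ 2 + sd ^+ 2 = 1 by rewrite sqrrN.
have I1 := integral_ball3 g mg g0 gfin q1 r1 r1_ge0.
have I2 := integral_ball3 g mg g0 gfin q2 r2 r2_ge0.
have IC1 := integral_cap3 g mg g0 gfin q1 ux uy cd sd r1 t1 true r1_ge0 u1 cd_sd t1_ge.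
have IC2 := integral_cap3 g mg g0 gfin q2 (- ux) (- uy) (- cd) sd r2 t2 false
  r2_ge0 nu1 ncd t2_ge.
have E1 : K1 `|` K2 = K1 `|` (K2 `\` K1).
  apply/seteqP; split => p [k|k]; [by left| |by left|by right; case: k].
  by have [k1|k1] := pselect (K1 p); [left|right].
have E2 : K2 = (K2 `\` K1) `|` (cap1 `|` cap2).
  rewrite -lensE; apply/seteqP; split => [p k|p [[]|[]]//].
  by have [k1|k1] := pselect (K1 p); [right|left].
have mD : measurable (K2 `\` K1) by exact: measurableD.
have IK2 : (\int[@leb3 R]_(p in K2) (g p.2)%:E =
    \int[@leb3 R]_(p in K2 `\` K1) (g p.2)%:E +
    (\int[@leb3 R]_(p in cap1) (g p.2)%:E + \int[@leb3 R]_(p in cap2) (g p.2)%:E))%E.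
  rewrite [in LHS]E2 split_int//; last 2 first.
  - exact: measurableU.
  - by rewrite -lensE; apply/disj_setPS => p [[_ k1] [/k1]].
  congr (_ + _)%E; apply: split_int => //.
  apply/disj_setPS => p [[_ /=]]; rewrite in_itv/= andbT => tw [_ /=].
  rewrite in_itv/= andbT; have := w12 p; have := t12; lra.
rewrite E1 split_int//; last by apply/disj_setPS => p [k1 [_ /(_ k1)]].
move: IK2; rewrite I1 I2 [X in (_ + (X + _))%E]IC1 [X in (_ + (_ + X))%E]IC2.
rewrite -/(ball_Rint q1.2 r1) -/(ball_Rint q2.2 r2).
rewrite -/(cap_Rint q1.2 r1 cd sd t1) -/(cap_Rint q2.2 r2 (- cd) sd t2).
move: (ball_Rint q1.2 r1) (ball_Rint q2.2 r2) (cap_Rint q1.2 r1 cd sd t1)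
  (cap_Rint q2.2 r2 (- cd) sd t2) => k1 k2 c1 c2.
(* The integral over the difference is never computed: its sum with the two caps is real, which
   excludes infinite values and determines it. *)
case: (\int[@leb3 R]_(p in K2 `\` K1) (g p.2)%:E)%E => [x|//|//] [->].
by rewrite -!EFinD; congr EFin; ring.
Qed.

End two_balls.

(** * Hyperbolic distance and hyperbolic balls *)

Section hyperbolic.
Context {R : realType}.
Implicit Types (a b p : pt R) (x y : R).

Lemma acosh_sqrt_ge0 x : 1 <= x -> 0 <= x ^+ 2 - 1.
Proof. by move=> x1; rewrite subr_ge0 exprn_ege1. Qed.

Lemma expR_acosh x : 1 <= x -> expR (acosh x) = x + Num.sqrt (x ^+ 2 - 1).
Proof.
move=> x1; rewrite /acosh lnK// posrE ltr_pwDl ?sqrtr_ge0//.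
exact: lt_le_trans x1.
Qed.

Lemma expRN_acosh x : 1 <= x -> expR (- acosh x) = x - Num.sqrt (x ^+ 2 - 1).
Proof.
move=> x1; rewrite expRN expR_acosh//; apply: mulr1_eq.
by rewrite mulrC -subr_sqr sqr_sqrtr ?acosh_sqrt_ge0//; ring.
Qed.

Lemma cosh_acosh x : 1 <= x -> cosh (acosh x) = x.
Proof. by move=> x1; rewrite /cosh expR_acosh// expRN_acosh//; field. Qed.

Lemma sinh_acosh x : 1 <= x -> sinh (acosh x) = Num.sqrt (x ^+ 2 - 1).
Proof. by move=> x1; rewrite /sinh expR_acosh// expRN_acosh//; field. Qed.

Lemma ltr_acosh x y : 1 <= x -> 1 <= y -> (acosh x < acosh y) = (x < y).
Proof.
move=> x1 y1; rewrite -ltr_expR !expR_acosh//.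
have mono u v : 1 <= u -> u <= v -> Num.sqrt (u ^+ 2 - 1) <= Num.sqrt (v ^+ 2 - 1).
  move=> u1 uv; apply: ler_wsqrtr; rewrite lerD2r lerXn2r// nnegrE.
    exact: le_trans u1.
  exact: le_trans (le_trans _ u1) uv.
have [xy|yx] := ltP x y; first by rewrite ltr_leD// mono// ltW.
by apply/negbTE; rewrite -leNgt lerD// mono.
Qed.

(** A default value: the argument of the logarithm is at most x + |x| = 0, and [ln] is 0 there. *)
Lemma acosh_le0 x : x <= 0 -> acosh x = 0.
Proof.
move=> x0; rewrite /acosh ln0//.
have : Num.sqrt (x ^+ 2 - 1) <= Num.sqrt (x ^+ 2).
  by apply: ler_wsqrtr; rewrite gerBl.
by rewrite sqrtr_sqr ler0_norm//; lra.
Qed.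

Lemma acosh_ge0 x : 1 <= x -> 0 <= acosh x.
Proof.
by move=> x1; apply: ln_ge0; rewrite (le_trans x1)// lerDl sqrtr_ge0.
Qed.

Definition cosh_dist a p : R :=
  dE a p ^+ 2 / (2 * a.2 * p.2) + 2^-1 * (a.2 / p.2 + p.2 / a.2).

Lemma dE_sqr a b : dE a b ^+ 2 = (a.1.1 - b.1.1) ^+ 2 + (a.1.2 - b.1.2) ^+ 2.
Proof. by rewrite sqr_sqrtr// addr_ge0// sqr_ge0. Qed.

Lemma dEC a b : dE a b = dE b a.
Proof. by rewrite /dE -[in RHS]sqrrN opprB -[in X in _ + X]sqrrN opprB. Qed.

Lemma dHC a b : dH a b = dH b a.
Proof.
rewrite /dH dEC; congr (acosh (_ / _ + _ * _)); last exact: addrC.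
by rewrite -!mulrA [b.2 * _]mulrC.
Qed.

Lemma cosh_distE a p : 0 < a.2 -> 0 < p.2 ->
  cosh_dist a p = 1 + (dE a p ^+ 2 + (a.2 - p.2) ^+ 2) / (2 * a.2 * p.2).
Proof. by move=> a0 p0; rewrite /cosh_dist; field; rewrite !gt_eqF. Qed.

Lemma cosh_dist_ge1 a p : 0 < a.2 -> 0 < p.2 -> 1 <= cosh_dist a p.
Proof.
move=> a0 p0; rewrite cosh_distE// lerDl divr_ge0 ?addr_ge0 ?sqr_ge0//.
by rewrite !mulr_ge0// ltW.
Qed.

(** Every term of the argument of [acosh] is nonpositive, including at height 0, where inverses are
    0. Such a point is thus at least as close to [a] as any other. *)
Lemma dH_below a p : 0 < a.2 -> p.2 <= 0 -> dH a p = 0.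
Proof.
move=> a0 p0; apply: acosh_le0.
have pi0 : p.2^-1 <= 0 by rewrite invr_le0.
rewrite -[leRHS]addr0 lerD//.
  rewrite mulr_ge0_le0 ?sqr_ge0// invr_le0 mulr_ge0_le0//.
  by rewrite mulr_ge0// ltW.
rewrite mulr_ge0_le0// -[leRHS]addr0 lerD//.
  by rewrite mulr_ge0_le0// ltW.
by rewrite mulr_le0_ge0// invr_ge0 ltW.
Qed.

(** By monotonicity of [acosh] the comparison is between hyperbolic cosines. Multiplying by 2 a.2
    p.2 and completing the square in p.2 gives centre height a.2 x and squared radius a.2^2 (x^2 -
    1). *)
Lemma hyperbolic_ballE a p x : 0 < a.2 -> 0 < p.2 -> 1 <= x ->
  (acosh x < dH a p)%R = ~~ ((p.1.1 - a.1.1) ^+ 2 + (p.1.2 - a.1.2) ^+ 2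
    + (p.2 - a.2 * cosh (acosh x)) ^+ 2 <= (a.2 * sinh (acosh x)) ^+ 2).
Proof.
move=> a0 p0 x1; rewrite ltr_acosh ?cosh_dist_ge1//.
rewrite -/(cosh_dist a p) cosh_acosh// sinh_acosh// exprMn sqr_sqrtr ?acosh_sqrt_ge0//.
rewrite -ltNge cosh_distE// -ltrBlDl ltr_pdivlMr ?mulr_gt0// dE_sqr.
by apply/idP/idP; lra.
Qed.

(** If p.2 <= 0, the vertical term alone is at least a.2^2 x^2, which exceeds a.2^2 (x^2 - 1). *)
Lemma hyperbolic_ball_above a p x : 0 < a.2 -> 1 <= x ->
  ball3 (a.1, a.2 * cosh (acosh x)) (a.2 * sinh (acosh x)) p -> 0 < p.2.
Proof.
move=> a0 x1; rewrite /ball3/= cosh_acosh// sinh_acosh// exprMn.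
rewrite sqr_sqrtr ?acosh_sqrt_ge0// => H; rewrite ltNge; apply/negP => p0.
have := sqr_ge0 (p.1.1 - a.1.1); have := sqr_ge0 (p.1.2 - a.1.2).
have : 0 <= - p.2 * (a.2 * x) by rewrite mulr_ge0 ?oppr_ge0// mulr_ge0 ?ltW//; lra.
have : 0 < a.2 ^+ 2 by rewrite exprn_gt0.
have := sqr_ge0 p.2.
by move: H; lra.
Qed.

End hyperbolic.

(** * Dependence on [f], the shape of [Fpair], and null sets *)

Section final_steps.
Context {R : realType}.
Local Notation mu := (@lebesgue_measure R).

(** The argument is the height of a point of the ball of radius [r] about height [c]. The identity
    [e] is Lagrange's, so the deviation [v] satisfies v^2 <= w^2 + rho^2 <= r^2. *)
Lemma cap_arg_gt0 (c r w rho t cd sd : R) : 0 <= r -> r < c ->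
  cd ^+ 2 + sd ^+ 2 = 1 -> 0 < rho <= Num.sqrt (r ^+ 2 - w ^+ 2) ->
  0 < c + w * cd - rho * cos t * sd.
Proof.
move=> r0 rc cs /andP[rho0 rhor].
have rw : 0 < r ^+ 2 - w ^+ 2 by rewrite -sqrtr_gt0 (lt_le_trans rho0).
have rho2 : rho ^+ 2 <= r ^+ 2 - w ^+ 2.
  by rewrite -(sqr_sqrtr (ltW rw)) lerXn2r ?nnegrE ?sqrtr_ge0// ltW.
have c2 : cos t ^+ 2 <= 1 by rewrite -(cos2Dsin2 t) lerDl sqr_ge0.
set v := w * cd - rho * cos t * sd.
have v2 : v ^+ 2 <= r ^+ 2.
  have e : (w ^+ 2 + (rho * cos t) ^+ 2) * (cd ^+ 2 + sd ^+ 2) =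
    v ^+ 2 + (w * sd + rho * cos t * cd) ^+ 2 by rewrite /v; ring.
  have := sqr_ge0 (w * sd + rho * cos t * cd).
  have : (rho * cos t) ^+ 2 <= rho ^+ 2 by rewrite exprMn ler_piMr ?sqr_ge0.
  by move: e rho2; rewrite cs mulr1; lra.
have : `|v| <= r.
  by move: v2; rewrite -(ler_sqrt _ (sqr_ge0 r)) !sqrtr_sqr (ger0_norm r0).
by rewrite ler_norml -addrA -/v => /andP[]; lra.
Qed.

Lemma cap_Rint_ext (f g : R -> R) (c r cd sd t : R) : 0 <= r -> r < c ->
  cd ^+ 2 + sd ^+ 2 = 1 -> (forall x, 0 < x -> f x = g x) ->
  cap_Rint f c r cd sd t = cap_Rint g c r cd sd t.
Proof.
move=> r0 rc cs fg; rewrite /cap_Rint.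
apply: eq_Rintegral => w _; apply: eq_Rintegral => th _.
apply: eq_Rintegral => rho; rewrite inE/= in_itv/= => /andP[].
(* At rho = 0 the factor rho hides the value of the density; a positive rho forces |w| < r. *)
rewrite le_eqVlt => /predU1P[<- _|rho0 rhor]; first by rewrite !mulr0.
by rewrite fg// (cap_arg_gt0 _ r)// rho0.
Qed.

Lemma ball_Rint_ext (f g : R -> R) (c r : R) : r < c ->
  (forall x, 0 < x -> f x = g x) -> ball_Rint f c r = ball_Rint g c r.
Proof.
move=> rc fg; rewrite /ball_Rint; congr (_ * _).
apply: eq_Rintegral => w; rewrite inE/= in_itv/= => /andP[w1 w2].
by rewrite fg//; lra.
Qed.

Lemma cos_pihalfB (v : R) : -1 <= v <= 1 -> cos (pi / 2 - asin v) = v.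
Proof. by move=> v1; rewrite -cosN opprB cosBpihalf asinK// in_itv. Qed.

Lemma sin_pihalfB (v : R) : -1 <= v <= 1 -> sin (pi / 2 - asin v) = Num.sqrt (1 - v ^+ 2).
Proof. by move=> v1; rewrite sinB cos_pihalf sin_pihalf mul0r subr0 mul1r cos_asin. Qed.

(** The angle delta is the inclination of the axis to the vertical: its cosine is (ct - c) / d and
    its sine s / d. The cap heights satisfy r - h = (d^2 + r^2 - rt^2) / (2 d), and
    symmetrically. *)
Lemma FpairE (f : R -> R) (s z zt : R) :
  let RR := acosh (s ^+ 2 / (2 * z * zt) + 2^-1 * (z / zt + zt / z)) in
  let d := Num.sqrt (s ^+ 2 + (z - zt) ^+ 2 * cosh RR ^+ 2) in
  let r := z * sinh RR in
  let rt := zt * sinh RR in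
  let c := z * cosh RR in
  let ct := zt * cosh RR in
  0 <= s -> 0 < d ->
  Fpair f s z zt = ball_Rint f c r + ball_Rint f ct rt
    - cap_Rint f c r ((ct - c) / d) (s / d) ((d ^+ 2 + r ^+ 2 - rt ^+ 2) / (2 * d))
    - cap_Rint f ct rt (- ((ct - c) / d)) (s / d) ((d ^+ 2 + rt ^+ 2 - r ^+ 2) / (2 * d)).
Proof.
move=> RR d r rt c ct s0 d0.
have d2 : d ^+ 2 = s ^+ 2 + (ct - c) ^+ 2.
  rewrite sqr_sqrtr; last first.
    by apply: addr_ge0; [|apply: mulr_ge0]; exact: sqr_ge0.
  by congr (_ + _); rewrite /ct /c; ring.
have v1 : -1 <= (ct - c) / d <= 1.
  rewrite -ler_norml normf_div (gtr0_norm d0) ler_pdivrMr// mul1r.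
  rewrite -[leRHS](gtr0_norm d0) -!sqrtr_sqr ler_wsqrtr// d2 lerDr.
  exact: sqr_ge0.
have vE : (c - ct) / d = - ((ct - c) / d) by ring.
have vt1 : -1 <= (c - ct) / d <= 1.
  by rewrite vE lerNr opprK lerNl andbC.
have sE : Num.sqrt (1 - ((ct - c) / d) ^+ 2) = s / d.
  have -> : 1 - ((ct - c) / d) ^+ 2 = (s / d) ^+ 2.
    rewrite !expr_div_n.
    have -> : (ct - c) ^+ 2 = d ^+ 2 - s ^+ 2 by rewrite d2; ring.
    by field; rewrite gt_eqF.
  by rewrite sqrtr_sqr ger0_norm// divr_ge0// ltW.
have h1 : r - (rt - r + d) * (r + rt - d) / (2 * d) =
    (d ^+ 2 + r ^+ 2 - rt ^+ 2) / (2 * d) by field; rewrite gt_eqF.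
have h2 : rt - (r - rt + d) * (r + rt - d) / (2 * d) =
    (d ^+ 2 + rt ^+ 2 - r ^+ 2) / (2 * d) by field; rewrite gt_eqF.
transitivity (ball_Rint f c r + ball_Rint f ct rt
  - cap_Rint f c r (cos (pi / 2 - asin ((ct - c) / d)))
      (sin (pi / 2 - asin ((ct - c) / d)))
      (r - (rt - r + d) * (r + rt - d) / (2 * d))
  - cap_Rint f ct rt (cos (pi / 2 - asin ((c - ct) / d)))
      (sin (pi / 2 - asin ((c - ct) / d)))
      (rt - (r - rt + d) * (r + rt - d) / (2 * d))); first by [].
rewrite (cos_pihalfB _ v1) (cos_pihalfB _ vt1) (sin_pihalfB _ v1) (sin_pihalfB _ vt1).
by rewrite vE sqrrN sE h1 h2.
Qed.

Lemma npoints_eq0 (phi B : set (pt R)) :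
  (npoints phi B = 0%:R%:E) <-> phi `&` B = set0.
Proof.
rewrite /npoints; split => [|->]; last by rewrite esum_set0.
move=> e0; apply/seteqP; split => // x xB.
have : (1 <= \esum_(x in phi `&` B) (1 : \bar R))%E.
  apply: esum_ge; exists [set x]; first by split; [exact: finite_set1|move=> _ ->].
  by rewrite fsbig_set1.
by rewrite e0 lee_fin ler10.
Qed.

Lemma leb3_set1 (a : pt R) : measurable [set a] /\ leb3 [set a] = 0%E.
Proof.
have aE : [set a] = ([set a.1.1] `*` [set a.1.2]) `*` [set a.2].
  by apply/seteqP; split => [p ->//|[[x y] z] [[/= -> ->] ->]]; case: a => -[].
have m1 (x : R) : measurable [set x] by exact: measurable_set1.
split; first by rewrite aE; apply: measurableX => //; exact: measurableX.
rewrite aE [LHS]product_measure1E//; last exact: measurableX.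
by rewrite [X in (_ * X)%E](_ : _ = 0%E) ?mule0//; exact: lebesgue_measure_set1.
Qed.

End final_steps.

(** Covers points on a common vertical line, where s = 0 and any horizontal direction serves. *)
Lemma unit_direction {R : realType} (u v s : R) : s ^+ 2 = u ^+ 2 + v ^+ 2 ->
  exists ux uy : R, [/\ ux ^+ 2 + uy ^+ 2 = 1, ux * s = u & uy * s = v].
Proof.
move=> sE; have [s0|s0] := eqVneq s 0.
  move: sE; rewrite s0 expr0n/= => /esym/eqP.
  rewrite paddr_eq0 ?sqr_ge0// !sqrf_eq0 => /andP[/eqP-> /eqP->].
  by exists 1, 0; rewrite !mulr0 expr1n expr0n addr0.
exists (u / s), (v / s); split; [|by rewrite divfK..].
by rewrite !expr_div_n -mulrDl -sE divff// expf_neq0.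
Qed.

Lemma sqr_div_pythagoras {R : realType} (d s e : R) : 0 < d ->
  d ^+ 2 = s ^+ 2 + e ^+ 2 -> (e / d) ^+ 2 + (s / d) ^+ 2 = 1.
Proof.
move=> d0 dE; rewrite !expr_div_n -mulrDl addrC -dE divff//.
by rewrite expf_neq0// gt_eqF.
Qed.

(** * The two hyperbolic balls of radius d(a, b) *)

Section hyperbolic_two_balls.
Context {R : realType}.
Variables (a b : pt R) (a0 : 0 < a.2) (b0 : 0 < b.2) (ab : a <> b).

Let C := cosh (dH a b).
Let S := sinh (dH a b).
Definition hball1 : set (pt R) := ball3 (a.1, a.2 * C) (a.2 * S).
Definition hball2 : set (pt R) := ball3 (b.1, b.2 * C) (b.2 * S).

Let x1 : 1 <= cosh_dist a b. Proof. exact: cosh_dist_ge1. Qed.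

Let S_ge0 : 0 <= S. Proof. by rewrite /S /dH sinh_acosh// sqrtr_ge0. Qed.

Let CE : C = cosh_dist a b. Proof. exact: cosh_acosh. Qed.

Let S2 : S ^+ 2 = C ^+ 2 - 1.
Proof. by rewrite CE /S /dH sinh_acosh// sqr_sqrtr// acosh_sqrt_ge0. Qed.

Let SC : S < C.
Proof.
have C1 : 1 <= C by rewrite CE.
have C0 : 0 <= C by exact: le_trans C1.
rewrite -[S]ger0_norm// -[C]ger0_norm// -!sqrtr_sqr ltr_sqrt ?S2 ?gtrBl//.
by rewrite exprn_gt0// (lt_le_trans _ C1).
Qed.

Let s := dE a b.
Let d := Num.sqrt (s ^+ 2 + (a.2 - b.2) ^+ 2 * C ^+ 2).

Let sum_ge0 : 0 <= s ^+ 2 + (a.2 - b.2) ^+ 2 * C ^+ 2.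
Proof. by apply: addr_ge0; [|apply: mulr_ge0]; exact: sqr_ge0. Qed.

Let d_gt0 : 0 < d.
Proof.
rewrite sqrtr_gt0 lt0r sum_ge0 andbT; apply/negP.
rewrite paddr_eq0 ?sqr_ge0//; last by apply: mulr_ge0; exact: sqr_ge0.
rewrite sqrf_eq0 mulf_eq0 !sqrf_eq0 => /andP[/eqP s0 zz].
have C1 : 1 <= C by rewrite CE.
have C0 : C == 0 = false by apply/negbTE; rewrite gt_eqF// (lt_le_trans _ C1).
move: zz; rewrite C0 orbF subr_eq0 => /eqP z12.
have /eqP := dE_sqr a b; rewrite -/s s0 expr0n/= eq_sym.
rewrite paddr_eq0 ?sqr_ge0// !sqrf_eq0 !subr_eq0 => /andP[/eqP e1 /eqP e2].
by apply: ab; move: z12 e1 e2; case: a => -[? ?] ?; case: b => -[? ?] ? /= -> -> ->.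
Qed.

Lemma integral_hyperbolic_balls (f g : R -> R) :
  measurable_fun [set: R] g -> (forall x, 0 <= g x) ->
  (\int[@lebesgue_measure R]_x (g x)%:E < +oo)%E ->
  (forall x, 0 < x -> f x = g x) ->
  (\int[@leb3 R]_(p in hball1 `|` hball2) (g p.2)%:E = (Fpair f s a.2 b.2)%:E)%E.
Proof.
move=> mg g0 gfin fg.
have d2E : d ^+ 2 = s ^+ 2 + (b.2 * C - a.2 * C) ^+ 2 by rewrite sqr_sqrtr//; ring.
have s2 : s ^+ 2 = (b.1.1 - a.1.1) ^+ 2 + (b.1.2 - a.1.2) ^+ 2.
  by rewrite dE_sqr; ring.
have [ux [uy [u1 uxE uyE]]] := unit_direction _ _ _ s2.
have r1 : 0 <= a.2 * S by rewrite mulr_ge0// ltW.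
have r2 : 0 <= b.2 * S by rewrite mulr_ge0// ltW.
(* Both radii carry the factor sinh R and the centre heights cosh R, so S^2 = C^2 - 1 is enough. *)
have dr : (a.2 * S - b.2 * S) ^+ 2 <= d ^+ 2.
  have -> : (a.2 * S - b.2 * S) ^+ 2 = (a.2 - b.2) ^+ 2 * S ^+ 2 by ring.
  have -> : d ^+ 2 = s ^+ 2 + (a.2 - b.2) ^+ 2 * C ^+ 2 by rewrite sqr_sqrtr.
  rewrite S2.
  have := sqr_ge0 s; have := sqr_ge0 (a.2 - b.2); lra.
rewrite (integral_two_balls g mg g0 gfin (a.1, a.2 * C) (b.1, b.2 * C) _ _ ux uy s d
  r1 r2 u1 uxE uyE d_gt0 d2E dr).
have s0 : 0 <= s by exact: sqrtr_ge0.
pose v := (b.2 * C - a.2 * C) / d.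
have FE : Fpair f s a.2 b.2 =
    ball_Rint f (a.2 * C) (a.2 * S) + ball_Rint f (b.2 * C) (b.2 * S)
    - cap_Rint f (a.2 * C) (a.2 * S) v (s / d)
        ((d ^+ 2 + (a.2 * S) ^+ 2 - (b.2 * S) ^+ 2) / (2 * d))
    - cap_Rint f (b.2 * C) (b.2 * S) (- v) (s / d)
        ((d ^+ 2 + (b.2 * S) ^+ 2 - (a.2 * S) ^+ 2) / (2 * d)) :=
  FpairE f s a.2 b.2 s0 d_gt0.
have rc1 : a.2 * S < a.2 * C by rewrite ltr_pM2l.
have rc2 : b.2 * S < b.2 * C by rewrite ltr_pM2l.
have cs : v ^+ 2 + (s / d) ^+ 2 = 1 := sqr_div_pythagoras _ _ _ d_gt0 d2E.
have ncs : (- v) ^+ 2 + (s / d) ^+ 2 = 1 by rewrite sqrrN.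
have B1 := ball_Rint_ext f g _ _ rc1 fg.
have B2 := ball_Rint_ext f g _ _ rc2 fg.
have L1 t := cap_Rint_ext f g _ _ _ _ t r1 rc1 cs fg.
have L2 t := cap_Rint_ext f g _ _ _ _ t r2 rc2 ncs fg.
pose sub (x y : R) := x - y.
exact (congr1 EFin (esym (eq_trans FE
  (f_equal2 sub (f_equal2 sub (f_equal2 +%R B1 B2) (L1 _)) (L2 _))))).
Qed.

Lemma hball1E p : 0 < p.2 -> hball1 p <-> ~ (dH a b < dH a p).
Proof.
by move=> p0; rewrite hyperbolic_ballE// /hball1 /ball3/=; split => [->//|/negP/negPn].
Qed.

Lemma hball2E p : 0 < p.2 -> hball2 p <-> ~ (dH b a < dH b p).
Proof.
move=> p0; rewrite (dHC b a) hyperbolic_ballE// /hball2 /ball3/=.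
by split => [->//|/negP/negPn].
Qed.

Lemma hballs_above : hball1 `|` hball2 `<=` [set p | 0 < p.2].
Proof. by move=> p []; exact: hyperbolic_ball_above. Qed.

End hyperbolic_two_balls.

(** * The relation as a void event of the process *)

Theorem theorem1 (R : realType) (d : measure_display) (Omega : measurableType d)
    (P : probability Omega R) (lam : R) (f : R -> R) (D : set (R * R))
    (Phi : Omega -> set (pt R)) :
  0 < lam ->
  measurable_fun [set z : R | 0 < z] f ->
  (forall z, 0 < z -> 0 <= f z) ->
  (\int[@lebesgue_measure R]_(z in [set z : R | (0 < z)%R]) (f z)%:E = 1)%E ->
  measurable D ->
  D `<=` [set zz | 0 < zz.1 /\ 0 < zz.2] ->
  (forall z zt, D (z, zt) -> D (zt, z)) ->
  is_PPP P (intensity lam f) Phi ->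
  forall a b : pt R, 0 < a.2 -> 0 < b.2 -> a <> b ->
    let E := [set w | mnn D (Phi w `|` [set a; b]) a b] in
    measurable E /\
    P E = (expR (- (lam * Fpair f (dE a b) a.2 b.2))
           * (if `[< D (a.2, b.2) >] then 1 else 0))%:E.
Proof.
move=> lam0 mf f0 f1 _ _ _ [Pm Pk] a b a0 b0 ab E.
pose g x := if 0 < x then f x else 0.
have mpos : measurable [set z : R | 0 < z].
  by rewrite -[X in measurable X](_ : `]0, +oo[%classic = _)// set_itvE.
have gE : g = f \_ [set z | 0 < z].
  apply/funext => x; rewrite patchE /g.
  by congr (if _ then _ else _); apply/idP/idP => [x0|/set_mem//]; apply/mem_set.
have mg : measurable_fun [set: R] g.
  by rewrite gE; apply/(measurable_restrictT _ mpos).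
have g0 x : 0 <= g x by rewrite /g; case: ifPn => // /f0.
have gfin : (\int[@lebesgue_measure R]_x (g x)%:E < +oo)%E.
  suff -> : (\int[@lebesgue_measure R]_x (g x)%:E = 1)%E by rewrite ltry.
  rewrite -f1 [RHS]integral_mkcond.
  by apply: eq_integral => x _; rewrite gE restrict_EFin.
have fg x : 0 < x -> f x = g x by rewrite /g => ->.
pose K1 := hball1 a b; pose K2 := hball2 a b.
(* Exactly the positions at which a point of [Phi] breaks the relation. The lower half-space belongs
   to it by [dH_below]; [a] and [b] are removed because [Phi] may contain them without harm. *)
pose B : set (pt R) := ([set p | p.2 <= 0] `|` (K1 `|` K2)) `\` ([set a] `|` [set b]).
have [ma na] := leb3_set1 a; have [mb nb] := leb3_set1 b.
have mK : measurable (K1 `|` K2).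
  by apply: measurableU; exact: measurable_ball3.
have mlow : measurable [set p : pt R | p.2 <= 0].
  rewrite -[X in measurable X]setTI.
  have : measurable_fun [set: pt R] (fun p : pt R => p.2 <= 0) by mfun.
  by move=> /(_ measurableT [set true] I).
have mB : measurable B.
  by apply: measurableD; exact: measurableU.
have BE p : B p <-> [/\ p <> a, p <> b & ~ (dH a b < dH a p /\ dH b a < dH b p)].
  have [p0|p0] := leP p.2 0.
    split=> [[_ /not_orP[pa pb]]|[pa pb _]].
      split => // -[]; rewrite (dH_below a p a0 p0); have := acosh_ge0 _ (cosh_dist_ge1 a b a0 b0).
      by rewrite -/(dH a b) leNgt => /negbTE ->.
    by split; [left|case].
  split=> [[[/= pl|kp] /not_orP[pa pb]]|[pa pb h]].
  - by move: pl; rewrite leNgt p0.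
  - split => // -[l1 l2]; case: kp.
      by move=> /(hball1E _ _ a0 b0 _ p0).
    by move=> /(hball2E _ _ a0 b0 _ p0).
  - split; last by case.
    right; have [k1|k1] := pselect (K1 p); first by left.
    right; apply/hball2E => // l2; apply: h; split => //.
    by apply: contrapT => /(hball1E _ _ a0 b0 _ p0).
(* [intensity] discards the lower half-space, and the two removed singletons are null for [leb3]. *)
have LamB : intensity lam f B = (lam * Fpair f (dE a b) a.2 b.2)%:E.
  rewrite /intensity EFinM; congr (_ * _)%E.
  have -> : B `&` [set q | 0 < q.2] = (K1 `|` K2) `\` [set a] `\` [set b].
    rewrite setDDl; apply/seteqP; split => p.
      by case=> -[[/= pl|kp] nab] /= p0; [move: pl; rewrite leNgt p0|split].
    case=> kp nab; split; last exact: hballs_above kp.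
    by split => //; right.
  have mgp (X : set (pt R)) : measurable_fun X (fun p : pt R => (g p.2)%:E).
    by apply: measurable_funTS; mfun.
  have gp0 (X : set (pt R)) (p : pt R) : X p -> (0 <= (g p.2)%:E)%E.
    by rewrite lee_fin.
  transitivity (\int[@leb3 R]_(p in (K1 `|` K2) `\` [set a] `\` [set b]) (g p.2)%:E)%E.
    apply: eq_integral => p /set_mem[[kp _] _].
    by rewrite fg//; exact: hballs_above kp.
  have mKa : measurable ((K1 `|` K2) `\` [set a]) by exact: measurableD.
  rewrite -(@ge0_negligible_integral _ _ R (@leb3 R) _ _ _ mb mKa (mgp _) (gp0 _) nb).
  rewrite -(@ge0_negligible_integral _ _ R (@leb3 R) _ _ _ ma mK (mgp _) (gp0 _) na).
  exact: integral_hyperbolic_balls.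
(* The events agree everywhere and not only almost surely, so the measurability of [E] comes from
   that of the counts. *)
have EE : E = if `[< D (a.2, b.2) >] then [set w | npoints (Phi w) B = 0%:R%:E]
              else set0.
  case: asboolP => Dab; last by apply/seteqP; split => // w [].
  apply/seteqP; split => w /=; rewrite npoints_eq0.
    case=> -[_ _ h1] [_ _ h2] _; apply/seteqP; split => // p [pw /BE[pa pb]]; apply.
    by split; [apply: h1|apply: h2] => //; left.
  move=> h; have hp p : (Phi w `|` [set a; b]) p -> p <> a -> p <> b ->
      dH a b < dH a p /\ dH b a < dH b p.
    case=> [pw pa pb|[]//]; apply: contrapT => hN.
    have : (Phi w `&` B) p by split => //; apply/BE.
    by rewrite h.
  split => //; split.
  - by right; right.
  - by move=> ba; apply: ab.
  - by move=> p pw pa pb; have [] := hp p pw pa pb.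
  - by right; left.
  - by [].
  - by move=> p pw pb pa; have [] := hp p pw pa pb.
rewrite EE; case: asboolP => Dab; last first.
  by split => //; rewrite measure0 mulr0.
split; first exact: Pm.
(* One set and count zero: the Poisson weight reduces to exp(- Lam B). *)
have := Pk 1%N (fun=> B) (fun=> 0%N).
rewrite big_ord1 LamB/= /Defs.poisson_pmf expr0 mul1r fact0 divr1 mulr1 => <- //.
- congr (P _); apply/seteqP; split => w /=; first by move=> ? ? _.
  by move=> /(_ ord0 I).
- by move=> _; rewrite ltry.
- by move=> i j; rewrite !ord1.
Qed.
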